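(* Let $\mathbb{F}$ be an algebraically closed field of characteristic different from $2$ and $G$ an abelian group. (1) Let $T$ be an elementary $2$-subgroup of rank $2m$ of $G$, let $t\in G\setminus T$ be an order $2$ element, and let $\tau\colon T\to\mathbb{F}$ be a quadratic form whose polar form $\beta\colon T\times T\to\mathbb{F}$ is a nondegenerate alternating bicharacter. Then $D_{\mathrm{inv}}(T,\beta,\tau)^{\mathrm{ex}}_t$ is a $G$-graded-division simple algebra with involution whose underlying algebra is not simple. (2) Given a $G$-graded-division simple algebra with involution $(D,\varphi_0,\Gamma)$ with $D$ not simple, there are an elementary $2$-subgroup $T$ of rank $2m$ of $G$, an order $2$ element $t\in G\setminus T$ and a quadratic form $\tau\colon T\to\mathbb{F}$ whose polar form is a nondegenerate alternating bicharacter $\beta\colon T\times T\to\mathbb{F}$ such that $$(D,\varphi_0,\Gamma)\cong D_{\mathrm{inv}}(T,\beta,\tau)^{\mathrm{ex}}_t.$$ (3) The algebras $D_{\mathrm{inv}}(T_1,\beta_1,\tau_1)^{\mathrm{ex}}_{t_1}$ and $D_{\mathrm{inv}}(T_2,\beta_2,\tau_2)^{\mathrm{ex}}_{t_2}$ are isomorphic (as $G$-graded algebras with involution) if and only if $T_1\langle t_1\rangle=T_2\langle t_2\rangle$, $t_1=t_2$, $\beta_1^{[t_1]}=\beta_2^{[t_2]}$ and $\tau_1^{[t_1]}=\tau_2^{[t_2]}$.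
   Context: All algebras are finite-dimensional. A $G$-graded-division simple algebra with involution $(D,\varphi_0,\Gamma)$ is a unital associative algebra $D$ with a $G$-grading $\Gamma$ in which every nonzero homogeneous element is invertible, together with an $\mathbb{F}$-linear degree-preserving involution $\varphi_0$, such that $D$ has no nonzero proper $\varphi_0$-stable two-sided ideals. Isomorphisms preserve product, involution and every homogeneous component. A bicharacter $\beta\colon T\times T\to\mathbb{F}$ takes values in $\mathbb{F}^\times$ and is multiplicative in each variable; alternating means $\beta(s,s)=1$ for all $s$. A quadratic form $\tau$ on an elementary $2$-group $T$ with polar form $\beta$ is a map with values in $\{\pm1\}$ such that $\beta(s_1,s_2)=\tau(s_1s_2)\tau(s_1)\tau(s_2)$. For $T$ an elementary $2$-group and $\beta$ nondegenerate alternating, $D(T,\beta)$ is the (unique up to isomorphism) graded-division algebra structure on a matrix algebra over $\mathbb{F}$ with support $T$ and one-dimensional homogeneous components $\mathbb{F}X_s$, $s\in T$, such that $X_{s_1}X_{s_2}=\beta(s_1,s_2)X_{s_2}X_{s_1}$. $D_{\mathrm{inv}}(T,\beta,\tau)$ is $D(T,\beta)$ with the involution $d\mapsto\tau(s)d$ for $d$ homogeneous of degree $s$. For a $G$-graded algebra with involution $(A,\varphi,\Gamma)$ and an order $2$ element $t\in G\setminus\mathrm{Supp}(\Gamma)$, $(A,\varphi,\Gamma)^{\mathrm{ex}}_t$ is $A\oplus A^{op}$ with involution $\mathrm{ex}(x,y)=(y,x)$ and the $G$-grading given by $\deg(x,\varphi(x))=h$, $\deg(x,-\varphi(x))=ht$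 for $x\in A_h$. For $\beta,\tau$ on $T$ and $t\notin T$ of order $2$, on $T\langle t\rangle$ define $\beta^{[t]}(ut^{k_1},vt^{k_2})=\beta(u,v)$ and $\tau^{[t]}(ut^k)=(-1)^k\tau(u)$ for $u,v\in T$ and $k,k_1,k_2\in\{0,1\}$. *)

(* Defs.v *)
From HB Require Import structures.
From mathcomp Require Import all_boot all_algebra all_field finmap.

Set Implicit Arguments.
Unset Strict Implicit.
Unset Printing Implicit Defensive.

Import GRing.Theory.
Local Open Scope ring_scope.

Section Converse.
Variables (F : fieldType) (A : falgType F).

HB.instance Definition _ := GRing.Lmodule.copy A^c A.
HB.instance Definition _ := Vector.copy A^c A.

Fact converse_scaleAl (k : F) (x y : A^c) : k *: (x * y) = (k *: x : A^c) * y.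
Proof. exact: (@scalerAr F A k y x). Qed.

Fact converse_scaleAr (k : F) (x y : A^c) : k *: (x * y) = x * (k *: y : A^c).
Proof. exact: (@scalerAl F A k y x). Qed.

HB.instance Definition _ :=
  GRing.LSemiModule_isLSemiAlgebra.Build F A^c converse_scaleAl.
HB.instance Definition _ :=
  GRing.LSemiAlgebra_isSemiAlgebra.Build F A^c converse_scaleAr.

End Converse.

HB.instance Definition _ (F : fieldType) (A B : falgType F) :=
  GRing.UnitAlgebra.on (A * B)%type.

(* Raw data (D, phi, Gamma); the axioms are imposed by the predicates below. *)
Record grInvAlg (F : fieldType) (G : groupType) := GrInvAlg {
  gia_alg :> falgType F;
  gia_inv : 'End(gia_alg);
  gia_gr : G -> {vspace gia_alg}
}.

Section Algebras.
Variable F : fieldType.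
Implicit Type A : falgType F.

Definition two_sided_ideal A (I : {vspace A}) :=
  ({:A} * I <= I)%VS /\ (I * {:A} <= I)%VS.

Definition simple_algebra A :=
  forall I : {vspace A}, two_sided_ideal I -> I = 0%VS \/ I = {:A}%VS.

Definition matrix_algebra A :=
  exists n (f : 'AHom(A, 'M[F]_n.+1)), bijective f.

Definition is_involution A (phi : 'End(A)) :=
  involutive phi /\ forall x y : A, phi (x * y) = phi y * phi x.

Definition simple_with_involution A (phi : 'End(A)) :=
  forall I : {vspace A}, two_sided_ideal I -> (phi @: I <= I)%VS ->
    I = 0%VS \/ I = {:A}%VS.

End Algebras.

Section Gradings.
Variables (F : fieldType) (G : groupType).
Implicit Types (A : falgType F) (D : grInvAlg F G) (g h t : G).

Definition is_grading A (Gamma : G -> {vspace A}) :=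
  [/\ forall x : A, exists s : seq G, x \in (\sum_(g <- s) Gamma g)%VS,
      forall (s : seq G) (y : G -> A), uniq s ->
        (forall g, y g \in Gamma g) -> \sum_(g <- s) y g = 0 ->
        {in s, forall g, y g = 0}
    & forall g h, (Gamma g * Gamma h <= Gamma (g * h)%g)%VS].

Definition graded_division A (Gamma : G -> {vspace A}) :=
  forall g (x : A), x \in Gamma g -> x != 0 -> x \is a GRing.unit.

Definition graded_division_simple_inv D :=
  [/\ is_grading (gia_gr D),
      graded_division (gia_gr D),
      is_involution (gia_inv D),
      forall g, (gia_inv D @: gia_gr D g <= gia_gr D g)%VS
    & simple_with_involution (gia_inv D)].

Definition gia_iso D1 D2 :=
  exists f : 'AHom(D1, D2),
    [/\ bijective f,
        forall x, f (gia_inv D1 x) = gia_inv D2 (f x)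
      & forall g, (f @: gia_gr D1 g)%VS = gia_gr D2 g].

Section Exchange.
Variables (A : falgType F) (phi : 'End(A)).

Definition ex_swap (z : A * A^c) : A * A^c := (z.2 : A, z.1 : A^c).
Definition ex_sym (x : A) : A * A^c := (x, phi x : A^c).
Definition ex_skew (x : A) : A * A^c := (x, - phi x : A^c).

Fact ex_swap_linear : linear ex_swap.
Proof. by []. Qed.

Fact ex_sym_linear : linear ex_sym.
Proof. by move=> k x y; rewrite /ex_sym linearP. Qed.

Fact ex_skew_linear : linear ex_skew.
Proof. by move=> k x y; rewrite /ex_skew linearP opprD -scalerN. Qed.

HB.instance Definition _ :=
  GRing.isLinear.Build F _ _ *:%R ex_swap ex_swap_linear.
HB.instance Definition _ :=
  GRing.isLinear.Build F _ _ *:%R ex_sym ex_sym_linear.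
HB.instance Definition _ :=
  GRing.isLinear.Build F _ _ *:%R ex_skew ex_skew_linear.

End Exchange.

(* An element of degree h of D contributes (x, phi x) in degree h and
   (x, - phi x) in degree h * t. *)
Definition gia_ex t D : grInvAlg F G :=
  @GrInvAlg F G (D * D^c)%type
    (linfun (@ex_swap D))
    (fun g => linfun (ex_sym (gia_inv D)) @: gia_gr D g
            + linfun (ex_skew (gia_inv D)) @: gia_gr D (g * t^-1)%g)%VS.

End Gradings.

Section Bicharacters.
Variables (F : fieldType) (G : groupType).
Implicit Types (T : {fset G}) (t g h : G) (beta : G -> G -> F) (tau : G -> F).

(* T is the image of an embedding of the additive group (Z/2)^r in G, which
   makes it a finite subgroup. *)
Definition elementary2_subgroup (r : nat) T :=
  exists f : 'rV['F_2]_r -> G,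
    [/\ forall u v, f (u + v) = (f u * f v)%g,
        injective f
      & forall g, g \in T <-> exists u, f u = g].

Definition has_order2 t := t != 1%g /\ (t * t)%g = 1%g.

(* Only the values of beta and tau on T are meaningful. *)
Definition bicharacter T beta :=
  [/\ {in T &, forall s u, beta s u != 0},
      {in T & &, forall s1 s2 u, beta (s1 * s2)%g u = beta s1 u * beta s2 u}
    & {in T & &, forall u s1 s2, beta u (s1 * s2)%g = beta u s1 * beta u s2}].

Definition alternating T beta := {in T, forall s, beta s s = 1}.

Definition nondegenerate T beta :=
  {in T, forall s, {in T, forall u, beta s u = 1} -> s = 1%g}.

Definition quadratic_form T tau beta :=
  {in T, forall s, tau s = 1 \/ tau s = -1} /\
  {in T &, forall s1 s2, beta s1 s2 = tau (s1 * s2)%g * tau s1 * tau s2}.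

Definition ex_datum (m : nat) T t beta tau :=
  [/\ elementary2_subgroup (2 * m) T,
      has_order2 t,
      t \notin T,
      quadratic_form T tau beta
    & [/\ bicharacter T beta, alternating T beta & nondegenerate T beta]].

(* The algebra D(T, beta), which is only defined up to isomorphism. *)
Definition is_D T beta (A : falgType F) (Gamma : G -> {vspace A}) :=
  [/\ matrix_algebra A, is_grading Gamma & graded_division Gamma] /\
  [/\ forall g, (Gamma g != 0%VS) = (g \in T),
      {in T, forall s, \dim (Gamma s) = 1%N}
    & {in T &, forall s1 s2, forall x1 x2 : A,
        x1 \in Gamma s1 -> x2 \in Gamma s2 ->
        x1 * x2 = beta s1 s2 *: (x2 * x1)}].

Definition is_Dinv T beta tau (D : grInvAlg F G) :=
  is_D T beta (gia_gr D) /\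
  {in T, forall s, forall d : D, d \in gia_gr D s -> gia_inv D d = tau s *: d}.

Definition adjoin T t : {fset G} := (T `|` [fset (u * t)%g | u in T])%fset.

Definition T_part T t g := if g \in T then g else (g * t^-1)%g.
Definition beta_ext T t beta g h : F := beta (T_part T t g) (T_part T t h).
Definition tau_ext T t tau g : F :=
  if g \in T then tau g else - tau (g * t^-1)%g.

Lemma elementary2_coset r T t u (k : bool) :
  elementary2_subgroup r T -> t \notin T -> u \in T ->
  ((u * t ^+ k)%g \in T) = ~~ k.
Proof.
case=> f [fM f_inj fT] tT uT; case: k; last by rewrite expg0 mulg1.
apply/negP; rewrite expg1 => /fT[v fv].
have [w fw] : exists w, f w = u by apply/fT.
case/negP: tT; apply/fT; exists (v - w); apply: (mulgI u).
by rewrite -fw -fM addrC subrK fv fw.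
Qed.

Lemma beta_extE r T t beta u v (k1 k2 : bool) :
  elementary2_subgroup r T -> t \notin T -> u \in T -> v \in T ->
  beta_ext T t beta (u * t ^+ k1)%g (v * t ^+ k2)%g = beta u v.
Proof.
move=> elT tT uT vT; rewrite /beta_ext /T_part.
rewrite !(elementary2_coset _ elT) //.
by case: k1; case: k2; rewrite ?expg0 ?expg1 ?mulg1 ?mulgK.
Qed.

Lemma tau_extE r T t tau u (k : bool) :
  elementary2_subgroup r T -> t \notin T -> u \in T ->
  tau_ext T t tau (u * t ^+ k)%g = (-1) ^+ k * tau u.
Proof.
move=> elT tT uT; rewrite /tau_ext (elementary2_coset _ elT) //.
by case: k; rewrite ?expg0 ?expg1 ?mulg1 ?mulgK ?mul1r ?mulN1r.
Qed.

End Bicharacters.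

(* Main.v *)
(* Call a grading a Pauli grading if its nonzero components are lines spanned by
   invertible elements, X_g X_h = b(g, h) X_h X_g, and the involution acts on the
   component of degree g by the scalar mu(g).
   The exchange algebra of D_inv(T, beta, tau) has a Pauli grading with support T<t>
   and data beta^[t], tau^[t], and the scalars by which conjugations by homogeneous
   elements and the involution act separate the degrees. Hence an ideal stable under
   the involution is graded, so it is 0 or everything.
   A Pauli grading whose support is an elementary 2-group is determined by b and mu:
   in the product E1 x E2 of two such algebras, choose for each generator of the
   support a pair of homogeneous elements of square 1; the ordered products of these
   pairs span the graph of an isomorphism E1 -> E2.
   Conversely, over an algebraically closed field the components of a graded-division
   algebra with involution phi are lines, phi acts on them by signs, and b(g, h) =
   mu(gh) mu(g) mu(h). Simplicity forbids a nontrivial g in the radical of b with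
   mu(g) = 1. So the support is an elementary 2-group and the radical is {1, t} if the
   algebra is not simple; T is any complement of t, its even rank comes from a maximal
   isotropic subspace, and D(T, beta) is realized by Pauli matrices. *)
Require Import Defs.
From HB Require Import structures.
From mathcomp Require Import all_boot all_algebra all_field finmap.
Import GRing.Theory.
Local Open Scope ring_scope.

Set Implicit Arguments.
Unset Strict Implicit.
Unset Printing Implicit Defensive.

(** * Separation of eigenvectors and existence of eigenvalues *)

(** Induction on [s]: an operator [L] separating [g0] from [g], minus [c g0], kills [y g0] and
    multiplies each other [y h] by [c h - c g0], nonzero at [h = g]. The operator may depend on the
    pair. A stable ideal taken for [I] is thus graded; [I = 0] gives linear independence. *)
Lemma eigen_separation (F : fieldType) (V : vectType F) (K : eqType)
    (I : {vspace V}) (s : seq K) (y : K -> V) :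
    uniq s ->
    (forall g h, g \in s -> h \in s -> g != h -> y g != 0 -> y h != 0 ->
       exists (L : 'End(V)) (c : K -> F),
         [/\ (L @: I <= I)%VS, forall k, k \in s -> L (y k) = c k *: y k
           & c g != c h]) ->
  \sum_(g <- s) y g \in I -> {in s, forall g, y g \in I}.
Proof.
elim: s y => [|g0 s IHs] y //= /andP[g0s us] sep; rewrite big_cons => sumI.
have [y0|y0] := eqVneq (y g0) 0.
  move=> g; rewrite inE => /predU1P[->|gs]; first by rewrite y0 mem0v.
  apply: IHs gs => //; last by rewrite y0 add0r in sumI.
  move=> g' h g's hs nz ng nh.
  have [|||||L [c [LI Ly cgh]]] := sep g' h; rewrite ?inE ?g's ?hs ?orbT //.
  by exists L, c; split=> // k ks; apply: Ly; rewrite inE ks orbT.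
have tailI: {in s, forall g, y g \in I}.
  move=> g gs; have [->|yg] := eqVneq (y g) 0; first exact: mem0v.
  have g0g : g0 != g by apply: contraNneq g0s => ->.
  have [|||||L [c [LI Ly cgh]]] := sep g0 g; rewrite ?inE ?eqxx ?gs ?orbT //.
  have: L (y g0 + \sum_(g <- s) y g) - c g0 *: (y g0 + \sum_(g <- s) y g) \in I.
    apply: memvB; last exact: memvZ.
    by apply: (subvP LI); apply: memv_img.
  rewrite linearD linear_sum /= Ly ?inE ?eqxx // scalerDr opprD addrACA subrr.
  rewrite add0r scaler_sumr -sumrB.
  rewrite (eq_big_seq (fun h => (c h - c g0) *: y h)); last first.
    by move=> h hs; rewrite /= Ly ?inE ?hs ?orbT // scalerBl.
  move/IHs => /(_ us _ g gs); rewrite rpredZeq subr_eq0 eq_sym (negbTE cgh).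
  apply=> h k hs ks hk; rewrite !scaler_eq0 !negb_or => /andP[_ nh] /andP[_ nk].
  have [|||||L' [c' [LI' Ly' cgh']]] := sep h k; rewrite ?inE ?hs ?ks ?orbT //.
  exists L', c'; split=> // j js.
  by rewrite linearZ /= Ly' ?inE ?js ?orbT // !scalerA mulrC.
move=> g; rewrite inE => /predU1P[->|]; last exact: tailI.
move: sumI; rewrite big_seq_cond rpredDr // rpred_sum // => h /andP[hs _].
exact: tailI.
Qed.

(** Finite dimension gives a nonzero polynomial killing [x]. It splits over the closed field, so a
    product of elements [x - z] is 0 and these cannot all be invertible. *)
Lemma exists_sub_scalar_nonunit (F : closedFieldType) (A : falgType F) (x : A) :
  exists a : F, x - a%:A \isn't a GRing.unit.
Proof.
(* One more coefficient than the dimension of [A], so evaluation at [x] has a nonzero kernel. *)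
pose f0 (v : 'rV[F]_(\dim {:A}).+1) : A := horner_alg x (rVpoly v).
have lin_f : linear f0.
  by move=> k u v; rewrite /f0 linearP rmorphD /= linearZ /= mulr_algl.
pose fL : {linear _ -> _} :=
  HB.pack f0 (GRing.isLinear.Build F _ _ *:%R f0 lin_f).
pose f := linfun fL.
have fE v : f v = horner_alg x (rVpoly v) by rewrite lfunE.
have kf : lker f != 0%VS.
  apply/negP=> /eqP k0; have := limg_ker_dim f fullv.
  rewrite k0 capv0 dimv0 add0n => E; have := dimvS (subvf (limg f)).
  by rewrite E [X in (X <= _)%N]dimvf dim_matrix mul1r ltnn.
have := memv_pick (lker f); rewrite memv_ker fE.
have := vpick0 (lker f); rewrite (negbTE kf); set v := vpick _ => v0.
set p := rVpoly v => /eqP px0.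
have p0 : p != 0.
  by apply: contraFN v0 => /eqP v0; rewrite -[v]rVpolyK -/p v0 linear0.
have [r Dp] := closed_field_poly_normal p.
have : horner_alg x (\prod_(z <- r) ('X - z%:P)) = 0.
  apply/eqP; move/eqP: px0; rewrite Dp linearZ /= mulr_algl scaler_eq0 lead_coef_eq0.
  by rewrite (negbTE p0).
rewrite rmorph_prod /= => prod0.
suff /hasP[z _ zU] : has (fun z => x - z%:A \isn't a GRing.unit) r by exists z.
apply: contraFT (@unitr0 A); rewrite -all_predC => /allP rU.
rewrite -prod0 big_seq; apply: rpred_prod => z /rU /=.
by rewrite negbK rmorphB /= horner_algX horner_algC.
Qed.

(** * Gradings *)

Lemma memv_sum_seqP (F : fieldType) (V : vectType F) (K : eqType) (s : seq K)
    (U : K -> {vspace V}) x :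
    uniq s -> x \in (\sum_(g <- s) U g)%VS ->
  exists2 y : K -> V, forall g, y g \in U g & x = \sum_(g <- s) y g.
Proof.
elim: s x => [|g0 s IHs] x /=.
  rewrite !big_nil memv0 => _ /eqP->.
  by exists (fun=> 0); rewrite ?big_nil // => g; apply: mem0v.
case/andP=> g0s us; rewrite big_cons => /memv_addP[x0 x0U [x1]].
case/(IHs _ us) => y yU -> ->; exists (fun g => if g == g0 then x0 else y g).
  by move=> g; case: eqP => [->|].
rewrite big_cons eqxx; congr (_ + _); apply: eq_big_seq => g gs.
by case: eqP gs g0s => // -> ->.
Qed.

Section Grading.
Variables (F : fieldType) (G : groupType) (A : falgType F).
Variables (Gamma : G -> {vspace A}) (grG : is_grading Gamma).

Lemma graded_mul g h x y :
  x \in Gamma g -> y \in Gamma h -> x * y \in Gamma (g * h)%g.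
Proof.
case: grG => _ _ grM xg yh; apply: (subvP (grM g h)); exact: memv_mul.
Qed.

(** Finitely many components contain a basis of [A], and directness makes every component outside
    them zero. The list is seeded with 1 for use in [graded_one]. *)
Lemma graded_finite : exists s : seq G,
  [/\ uniq s, 1%g \in s, forall g, Gamma g != 0%VS -> g \in s
    & forall x, exists2 y : G -> A,
        forall g, y g \in Gamma g & x = \sum_(g <- s) y g].
Proof.
have [sum dir _] := grG.
have [s [s1 fs]] : exists s, 1%g \in s /\ ({:A} <= \sum_(g <- s) Gamma g)%VS.
  rewrite -(span_basis (vbasisP {:A})).
  elim: (vbasis _ : seq A) => [|x X [s [s1 sX]]].
    by exists [:: 1%g]; rewrite span_nil sub0v mem_head.
  have [s' xs'] := sum x; exists (s' ++ s); rewrite mem_cat s1 orbT; split=> //.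
  by rewrite span_cons big_cat addvS.
have dec x : exists2 y : G -> A,
    forall g, y g \in Gamma g & x = \sum_(g <- undup s) y g.
  apply: memv_sum_seqP; rewrite ?undup_uniq // big_undup; last exact: addvv.
  by apply: (subvP fs); apply: memvf.
exists (undup s); split; rewrite ?undup_uniq ?mem_undup // => g; apply: contraR => gs.
apply/eqP/vspaceP=> x; rewrite memv0; apply/idP/eqP=> [xg|->]; last exact: mem0v.
have [y yG Dx] := dec x.
have := dir (g :: undup s) (fun h => if h == g then x else - y h).
move/(_ _ _ _ g); rewrite eqxx inE eqxx; apply=> //=.
- by rewrite gs undup_uniq.
- by move=> h; case: eqP => [->|_] //; rewrite memvN.
rewrite big_cons eqxx {1}Dx -big_split big1_seq //= => h.
by case: eqP gs => [->/negbTE->|_ _ _]; rewrite ?subrr.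
Qed.

Lemma graded_ind (P : A -> Prop) :
    P 0 -> (forall x y, P x -> P y -> P (x + y)) ->
    (forall g x, x \in Gamma g -> P x) ->
  forall x, P x.
Proof.
move=> P0 PD PG x; have [s [_ _ _ dec]] := graded_finite.
have [y yG ->] := dec x; elim/big_ind: _ => // g _; exact: PG (yG g).
Qed.

Lemma graded_disjoint g h x : x \in Gamma g -> x \in Gamma h -> x != 0 -> g = h.
Proof.
case: grG => _ dir _ xg xh; apply: contraNeq => gh.
have := dir [:: g; h] (fun k => if k == g then x else if k == h then - x else 0).
move/(_ _ _ _ g); rewrite eqxx inE eqxx => ->//=.
- by rewrite inE gh.
- move=> k; do 2?case: eqP => [->|_] //; rewrite ?memvN ?mem0v //.
- by rewrite !big_cons big_nil eqxx (negbTE (_ : h != g)) 1?eq_sym // eqxx addr0 subrr.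
Qed.

(** The component [e 1] of 1 in degree 1 is a right identity: for [x] of degree [g], comparing the
    components of degree [g] in [x = x * 1] gives [x = x * e 1]. *)
Lemma graded_one : 1 \in Gamma 1%g.
Proof.
have [s [us s1 sG dec]] := graded_finite; have [_ dir _] := grG.
have [e eG De] := dec 1.
suff /(_ 1) : forall x, x * e 1%g = x by rewrite mul1r => <-; apply: eG.
apply: graded_ind => [|x y Ex Ey|g x xg]; rewrite ?mul0r ?mulrDl ?Ex ?Ey //.
(* [y k] is the component of degree [k] of [x * 1 - x]. *)
pose y k := x * e (g^-1 * k)%g - (if k == g then x else 0).
have gs : g \in [seq (g * h)%g | h <- s].
  by apply/mapP; exists 1%g; rewrite ?mulg1.
have := dir [seq (g * h)%g | h <- s] y; move/(_ _ _ _ g gs).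
rewrite /y eqxx mulVg => /(_ _ _ _)/subr0_eq; apply.
- by rewrite map_inj_uniq //; apply: mulgI.
- move=> k; rewrite memvB //; last by case: eqP => [->|]; rewrite ?mem0v.
  by have := graded_mul xg (eG (g^-1 * k)%g); rewrite mulVKg.
rewrite sumrB -big_mkcond big_map; under eq_bigr do rewrite mulKg.
rewrite -mulr_sumr -De mulr1 -big_filter filter_pred1_uniq ?big_seq1 ?subrr //.
by rewrite map_inj_uniq //; apply: mulgI.
Qed.

End Grading.

(** * Pauli gradings *)

Lemma scalerIv (F : fieldType) (V : lmodType F) (v : V) :
  v != 0 -> injective (fun a : F => a *: v).
Proof.
move=> v0 a b /eqP; rewrite -subr_eq0 -scalerBl scaler_eq0 (negbTE v0) orbF.
by rewrite subr_eq0 => /eqP.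
Qed.

Lemma ideal_unit (F : fieldType) (A : falgType F) (I : {vspace A}) (x : A) :
  two_sided_ideal I -> x \in I -> x \is a GRing.unit -> I = fullv.
Proof.
move=> [lI _] xI xU; apply/eqP; rewrite eqEsubv subvf; apply/subvP=> y _.
by rewrite -[y](divrK xU); apply: (subvP lI); rewrite memv_mul ?memvf.
Qed.

Section PauliGradings.
Variables (F : fieldType) (G : groupType).
Implicit Types (S : {fset G}) (b : G -> G -> F) (mu : G -> F).
Implicit Types (D E : grInvAlg F G).

(** The last two fields range over all degrees: components outside [S] are zero, so [b] and [mu] are
    constrained on [S] only. *)
Record pauli_graded S b mu E : Prop := PauliGraded {
  pauli_grading : is_grading (gia_gr E);
  pauli_division : graded_division (gia_gr E);
  pauli_support : forall g, (gia_gr E g != 0%VS) = (g \in S);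
  pauli_dim : {in S, forall g, \dim (gia_gr E g) = 1%N};
  pauli_comm : forall g h x y, x \in gia_gr E g -> y \in gia_gr E h ->
    x * y = b g h *: (y * x);
  pauli_inv : forall g x, x \in gia_gr E g -> gia_inv E x = mu g *: x
}.

Section Theory.
Variables (S : {fset G}) (b : G -> G -> F) (mu : G -> F) (E : grInvAlg F G).
Hypothesis pE : pauli_graded S b mu E.

Lemma pauli_ex g : g \in S -> exists2 x, x \in gia_gr E g & x != 0.
Proof.
by rewrite -(pauli_support pE) => g0; exists (vpick (gia_gr E g)); rewrite ?memv_pick ?vpick0.
Qed.

Lemma pauli_supp g x : x \in gia_gr E g -> x != 0 -> g \in S.
Proof.
move=> xg; apply: contraNT; rewrite -(pauli_support pE) negbK => /eqP g0.
by rewrite g0 memv0 in xg.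
Qed.

Lemma pauli_unit g x : x \in gia_gr E g -> x != 0 -> x \is a GRing.unit.
Proof. exact: (pauli_division pE). Qed.

Lemma pauli_line g x : x \in gia_gr E g -> x != 0 -> (gia_gr E g) = <[x]>%VS.
Proof.
move=> xg x0; apply/eqP; rewrite eq_sym eqEdim -memvE xg dim_vline x0.
by rewrite (pauli_dim pE) // (pauli_supp xg).
Qed.

Lemma pauli_lineP g x y : x \in gia_gr E g -> x != 0 -> y \in gia_gr E g ->
  exists a, y = a *: x.
Proof. by move=> xg x0; rewrite (pauli_line xg x0) => /vlineP. Qed.

Lemma pauli_mul_neq0 g h x y : x \in gia_gr E g -> y \in gia_gr E h -> x != 0 -> y != 0 ->
  x * y != 0.
Proof. by move=> xg yh x0 y0; rewrite mulrI_eq0 //; apply/mulrI/(pauli_unit xg). Qed.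

Lemma pauli_supp1 : 1%g \in S.
Proof. exact: (pauli_supp (graded_one (pauli_grading pE)) (oner_neq0 _)). Qed.

Lemma pauli_suppM g h : g \in S -> h \in S -> (g * h)%g \in S.
Proof.
move=> /pauli_ex[x xg x0] /pauli_ex[y yh y0].
apply: pauli_supp (graded_mul (pauli_grading pE) xg yh) _.
exact: (pauli_mul_neq0 xg yh).
Qed.

(** Moving a homogeneous element past a product at once or factor by factor gives two scalars on the
    same nonzero product. *)
Lemma pauli_bicharacter : bicharacter S b.
Proof.
have gM := graded_mul (pauli_grading pE).
split.
- move=> g h /pauli_ex[x xg x0] /pauli_ex[y yh y0].
  apply: contraNneq (pauli_mul_neq0 xg yh x0 y0) => b0.
  by rewrite (pauli_comm pE xg yh) b0 scale0r.
- move=> g g' h /pauli_ex[x xg x0] /pauli_ex[x' xg' x0'] /pauli_ex[y yh y0].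
  apply: (@scalerIv _ _ (y * (x * x'))).
    by apply: pauli_mul_neq0 yh (gM _ _ _ _ xg xg') y0 (pauli_mul_neq0 xg xg' _ _).
  rewrite -(pauli_comm pE (gM _ _ _ _ xg xg') yh) -mulrA (pauli_comm pE xg' yh).
  by rewrite -scalerAr (mulrA x) (pauli_comm pE xg yh) -scalerAl scalerA mulrC mulrA.
- move=> h g g' /pauli_ex[y yh y0] /pauli_ex[x xg x0] /pauli_ex[x' xg' x0'].
  apply: (@scalerIv _ _ ((x * x') * y)).
    by apply: pauli_mul_neq0 (gM _ _ _ _ xg xg') yh (pauli_mul_neq0 xg xg' _ _) y0.
  rewrite -(pauli_comm pE yh (gM _ _ _ _ xg xg')) mulrA (pauli_comm pE yh xg).
  by rewrite -scalerAl -(mulrA x y) (pauli_comm pE yh xg') -scalerAr scalerA mulrA.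
Qed.

Lemma pauli_alternating : alternating S b.
Proof.
move=> g /pauli_ex[x xg x0]; apply: (@scalerIv _ _ (x * x)).
  exact: (pauli_mul_neq0 xg xg).
by rewrite scale1r -(pauli_comm pE xg xg).
Qed.

(** Conjugation by an element of degree [u] scales degree [g] by [b u g], the involution by [mu g].
    By [eigen_separation] the components of a nonzero element of [I] lie in [I], and a nonzero one
    is a unit. Stability under the involution is asked only where [mu] separates, so that ordinary
    ideals are covered too. *)
Lemma pauli_ideal (I : {vspace E}) :
    two_sided_ideal I -> I != 0%VS ->
    (forall g h, g \in S -> h \in S -> g != h ->
       (exists2 u, u \in S & b u g != b u h)
       \/ (gia_inv E @: I <= I)%VS /\ mu g != mu h) ->
  I = fullv.
Proof.
move=> idI I0 sep; have [lI rI] := idI.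
have [s [us _ _ dec]] := graded_finite (pauli_grading pE).
have [y yG Dx] := dec (vpick I).
have xI := memv_pick I; rewrite Dx in xI.
have yI : {in s, forall g, y g \in I}.
  apply: eigen_separation us _ xI => g h gs hs gh yg yh.
  have [[u uS bu]|[pI mgh]] := sep g h (pauli_supp (yG g) yg) (pauli_supp (yG h) yh) gh.
    have [z zu z0] := pauli_ex uS; have zU := pauli_unit zu z0.
    exists (amull z \o amulr (z^-1)%R)%VF, (b u); split=> // [|k _].
      apply/subvP=> _ /memv_imgP[w wI ->]; rewrite comp_lfunE !lfunE /=.
      apply: (subvP lI); apply: memv_mul (memvf _) _.
      by apply: (subvP rI); apply: memv_mul wI (memvf _).
    rewrite comp_lfunE !lfunE /= mulrA (pauli_comm pE zu (yG k)).
    by rewrite -scalerAl mulrK.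
  by exists (gia_inv E), mu; split=> // k _; apply: (pauli_inv pE (yG k)).
have /hasP[g gs yg] : has (fun g => y g != 0) s.
  apply: contraR I0 => /hasPn y0; rewrite -vpick0 Dx big1_seq // => g /andP[_ gs].
  by apply/eqP; have := y0 g gs; rewrite negbK.
exact: (ideal_unit idI (yI g gs)) (pauli_unit (yG g) yg).
Qed.

Lemma pauli_inv_stable g : (gia_inv E @: (gia_gr E g) <= (gia_gr E g))%VS.
Proof.
by apply/subvP=> _ /memv_imgP[x xg ->]; rewrite (pauli_inv pE xg) memvZ.
Qed.

(** On homogeneous elements [x * y = b g h *: (y * x)], so reversing products amounts to
    [mu (g * h) * b g h = mu g * mu h]. *)
Lemma pauli_involution :
    {in S, forall g, mu g * mu g = 1} ->
    {in S &, forall g h, mu (g * h)%g * b g h = mu g * mu h} ->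
  is_involution (gia_inv E).
Proof.
move=> mu2 muM; have gr := pauli_grading pE; split.
  apply: (graded_ind gr) => [|x y Ex Ey|g x xg]; first by rewrite !linear0.
    by rewrite !linearD /= Ex Ey.
  have [->|x0] := eqVneq x 0; first by rewrite !linear0.
  rewrite !(pauli_inv pE xg) linearZ /= (pauli_inv pE xg) scalerA mu2 ?scale1r //.
  exact: pauli_supp xg x0.
move=> x y; elim/(graded_ind gr): x => [|x x' Ex Ex'|g x xg].
- by rewrite mul0r linear0 mulr0.
- by rewrite mulrDl !linearD /= Ex Ex' mulrDr.
elim/(graded_ind gr): y => [|y y' Ey Ey'|h y yh].
- by rewrite mulr0 linear0 mul0r.
- by rewrite mulrDr !linearD /= Ey Ey' mulrDl.
have [->|x0] := eqVneq x 0; first by rewrite mul0r !linear0 mulr0.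
have [->|y0] := eqVneq y 0; first by rewrite mulr0 !linear0 mul0r.
rewrite (pauli_inv pE (graded_mul gr xg yh)) (pauli_inv pE xg) (pauli_inv pE yh).
rewrite (pauli_comm pE xg yh) -scalerAl -scalerAr !scalerA muM; first by rewrite mulrC.
  exact: pauli_supp xg x0.
exact: pauli_supp yh y0.
Qed.

End Theory.

Lemma pauli_gia_iso S1 S2 b1 b2 mu1 mu2 E1 E2 :
    pauli_graded S1 b1 mu1 E1 -> pauli_graded S2 b2 mu2 E2 -> gia_iso E1 E2 ->
  [/\ S1 = S2, {in S1 &, b1 =2 b2} & {in S1, mu1 =1 mu2}].
Proof.
move=> p1 p2 [f [fbij fi fG]].
have f0 x : x != 0 -> f x != 0.
  by apply: contraNneq => fx0; apply/eqP/(bij_inj fbij); rewrite fx0 linear0.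
have fg g x : x \in gia_gr E1 g -> f x \in gia_gr E2 g.
  by move=> xg; rewrite -fG memv_img.
split.
- apply/fsetP=> g; rewrite -(pauli_support p1) -(pauli_support p2) -fG; congr negb.
  apply/eqP/eqP=> [->|f0']; first by rewrite limg0.
  apply/eqP; rewrite -vpick0; apply: contraTT isT => /f0.
  by have := memv_img f (memv_pick (gia_gr E1 g)); rewrite f0' memv0 => ->.
- move=> g h /(pauli_ex p1)[x xg x0] /(pauli_ex p1)[y yh y0].
  apply: (@scalerIv _ _ (f y * f x)).
    by apply: (pauli_mul_neq0 p2 (fg _ _ yh) (fg _ _ xg)); apply: f0.
  rewrite -(pauli_comm p2 (fg _ _ xg) (fg _ _ yh)) -!rmorphM /=.
  by rewrite (pauli_comm p1 xg yh) linearZ.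
- move=> g /(pauli_ex p1)[x xg x0]; apply: (@scalerIv _ _ (f x)); first exact: f0.
  by rewrite -(pauli_inv p2 (fg _ _ xg)) -fi (pauli_inv p1 xg) linearZ.
Qed.

End PauliGradings.

(** * The exchange construction *)

Section Exchange.
Variables (F : fieldType) (G : groupType).
Hypothesis charF : 2%N \notin [pchar F].
Hypothesis abG : forall g h : G, (g * h)%g = (h * g)%g.

Lemma two_neq0 : 2%:R != 0 :> F.
Proof. by move: charF; rewrite inE /=. Qed.

Lemma addrr_eq0 (V : lmodType F) (x : V) : (x + x == 0) = (x == 0).
Proof. by rewrite -mulr2n -scaler_nat scaler_eq0 (negbTE two_neq0). Qed.

Variables (D : grInvAlg F G) (t : G).
Hypothesis ord2 : has_order2 t.
Local Notation A := (gia_alg D).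
Local Notation phi := (gia_inv D).
Local Notation Gamma := (gia_gr D).
Local Notation Ex := (gia_ex t D).

Lemma order2V : (t^-1 = t)%g.
Proof. by case: ord2 => _ /mulg1_eq. Qed.

(** Here [t] is its own inverse; [x] comes from the symmetric part and [y] from the skew part, whose
    sign is absorbed in [phi (x - y)]. *)
Lemma mem_gia_ex g (z : Ex) : reflect
  (exists x y, [/\ x \in Gamma g, y \in Gamma (g * t)%g & z = (x + y, phi (x - y))])
  (z \in gia_gr Ex g).
Proof.
rewrite /gia_ex /= order2V; apply: (iffP memv_addP) => [[_ /memv_imgP[x xg ->]]|].
  case=> _ /memv_imgP[y yg ->] ->; exists x, y; split=> //.
  by rewrite !lfunE /= linearB.
case=> x [y [xg yg ->]]; exists (linfun (ex_sym phi) x); first exact: memv_img.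
exists (linfun (ex_skew phi) y); first exact: memv_img.
by rewrite !lfunE /= linearB.
Qed.

Hypothesis grD : is_grading Gamma.
Hypothesis invD : is_involution phi.

(** A pair [(a, c)] is [(x, phi x) + (y, - phi y)] with [x] and [y] the halves of [a + phi c] and
    [a - phi c]; the characteristic is not 2. Directness is inherited from [Gamma] by recovering [x]
    and [y]. *)
Lemma gia_ex_grading : is_grading (gia_gr Ex).
Proof.
have [_ dir _] := grD; have [phiK phiM] := invD; have [_ t2] := ord2.
split.
- pose P (z : Ex) := exists s, z \in (\sum_(g <- s) gia_gr Ex g)%VS.
  have PD z w : P z -> P w -> P (z + w).
    by case=> s zs [s' ws]; exists (s ++ s'); rewrite big_cat memv_add.
  have P1 g z : z \in gia_gr Ex g -> P z by exists [:: g]; rewrite big_seq1.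
  have Psym x : P (x, phi x).
    elim/(graded_ind grD): x => [|x y Px Py|g x xg].
    + by exists [::]; rewrite linear0 mem0v.
    + by have := PD _ _ Px Py; rewrite linearD.
    apply: (P1 g); apply/mem_gia_ex.
    by exists x, 0; rewrite xg mem0v addr0 subr0.
  have Pskew x : P (x, - phi x).
    elim/(graded_ind grD): x => [|x y Px Py|g x xg].
    + by exists [::]; rewrite linear0 oppr0 mem0v.
    + by have := PD _ _ Px Py; rewrite linearD opprD.
    apply: (P1 (g * t)%g); apply/mem_gia_ex.
    by exists 0, x; rewrite -mulgA t2 mulg1 xg mem0v add0r sub0r linearN.
  move=> [a c]; have h2 := two_neq0.
  have := PD _ _ (Psym (2%:R^-1 *: (a + phi c))) (Pskew (2%:R^-1 *: (a - phi c))).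
  have half (x : A) : 2%:R^-1 *: (x + x) = x.
    by rewrite -mulr2n -scaler_nat scalerA mulVf ?scale1r.
  congr (P _); congr (_, _) => /=.
    by rewrite -scalerDr addrACA subrr addr0 half.
  rewrite -[LHS]/(phi _ - phi _ : A) -linearB -scalerBr opprD opprK addrACA subrr.
  by rewrite add0r half -[RHS]phiK.
- move=> s z us zG sum0.
  (* [p] and [q] return [x + x] and [y + y] on the pair built from [x] and [y]. *)
  pose p (w : Ex) : A := w.1 + phi w.2; pose q (w : Ex) : A := w.1 - phi w.2.
  have pqE g : exists x y, [/\ x \in Gamma g, y \in Gamma (g * t)%g,
     p (z g) = x + x, q (z g) = y + y & z g = (x + y, phi (x - y))].
    have /mem_gia_ex[x [y [xg yg Dz]]] := zG g; exists x, y; split=> //.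
      by rewrite /p Dz /= phiK addrACA subrr addr0.
    by rewrite /q Dz /= phiK opprD opprK addrACA subrr add0r.
  have sum1 : \sum_(g <- s) (z g).1 = 0.
    by rewrite -(raddf_sum (@fst A A^c)) sum0.
  have sum2 : \sum_(g <- s) ((z g).2 : A) = 0.
    have: \sum_(g <- s) (z g).2 = 0 by rewrite -(raddf_sum (@snd A A^c)) sum0.
    exact.
  have p0 : {in s, forall g, p (z g) = 0}.
    apply: dir us _ _ => [g|].
      by have [x [y [xg _ -> _ _]]] := pqE g; rewrite memvD.
    by rewrite big_split /= sum1 -raddf_sum sum2 raddf0 addr0.
  have q0 : {in s, forall g, q (z g) = 0}.
    (* [q (z g)] has degree [g * t], so the family is reindexed by translation by [t]. *)
    move=> g gs; have := dir [seq (g * t)%g | g <- s] (fun k => q (z (k * t)%g)).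
    move/(_ _ _ _ (g * t)%g); rewrite -mulgA t2 mulg1; apply.
    + by rewrite map_inj_uniq //; apply: mulIg.
    + move=> k; have [x [y [_ yg _ -> _]]] := pqE (k * t)%g.
      by rewrite -mulgA t2 mulg1 in yg; rewrite memvD.
    + rewrite big_map; under eq_bigr do rewrite -mulgA t2 mulg1.
      by rewrite sumrB sum1 -raddf_sum sum2 raddf0 subr0.
    + exact: map_f.
  move=> g gs; have [x [y [_ _ /eqP Dx /eqP Dy Dz]]] := pqE g; move: Dx Dy.
  rewrite p0 // q0 // !(eq_sym 0) !addrr_eq0 Dz => /eqP-> /eqP->.
  by rewrite addr0 subr0 linear0.
- move=> g h; apply/prodvP=> z w /mem_gia_ex[x [y [xg yg ->]]].
  case/mem_gia_ex=> [x' [y' [xh yh ->]]]; have gM := graded_mul grD.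
  (* Degrees [g * t] and [h * t] multiply to [g * h], so [y * y'] joins [x * x'], and the mixed
     products form the skew part. *)
  apply/mem_gia_ex; exists (x * x' + y * y'), (x * y' + y * x'); split.
  + rewrite memvD ?(gM _ _ _ _ xg xh) //; have := gM _ _ _ _ yg yh.
    by rewrite -!mulgA (mulgA t) (abG t) -mulgA t2 mulg1.
  + rewrite memvD //; first by have := gM _ _ _ _ xg yh; rewrite mulgA.
    by have := gM _ _ _ _ yg xh; rewrite -!mulgA (abG t).
  congr (_, _).
    by rewrite /= mulrDl !mulrDr -!addrA; congr (_ + _); rewrite addrA addrC.
  transitivity (phi ((x - y) * (x' - y'))); first by rewrite phiM.
  congr (phi _); rewrite mulrBl !mulrBr opprB opprD -!addrA; congr (_ + _).
  by rewrite addrCA.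
Qed.

Lemma gia_ex_involution : is_involution (gia_inv Ex).
Proof.
split=> [z|z w]; rewrite /= !lfunE //; first by case: z.
Qed.

Lemma gia_ex_not_simple : ~ simple_algebra Ex.
Proof.
pose I : {vspace Ex} := lker (linfun (@snd A A^c)).
have memI (z : Ex) : (z \in I) = (z.2 == 0) by rewrite memv_ker lfunE.
move/(_ I)=> [].
- by split; apply/prodvP=> z w; rewrite !memI /= => + +; 
    [move=> _ /eqP->|move=> /eqP-> _]; rewrite ?mulr0 ?mul0r.
- move=> I0; have : ((1, 0) : Ex) \in I by rewrite memI.
  by rewrite I0 memv0 => /eqP[/eqP]; rewrite oner_eq0.
move=> If; have : ((0, 1) : Ex) \in I by rewrite If memvf.
by rewrite memI oner_eq0.
Qed.

End Exchange.

(** * Elementary 2-groups and the Pauli data of the exchange algebra *)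

Lemma addrF2 (x : 'F_2) : x + x = 0.
Proof. by apply: addrr_pchar2; apply: pchar_Fp. Qed.

Lemma addmxF2 m n (A : 'M['F_2]_(m, n)) : A + A = 0.
Proof. by apply/matrixP=> i j; rewrite !mxE addrF2. Qed.

Lemma F2_cases (k : 'F_2) : k = 0 \/ k = 1.
Proof.
case: k => -[|[|//]] lt_k; [left | right]; exact: val_inj.
Qed.

Section Datum.
Variables (F : fieldType) (G : groupType).
Hypothesis charF : 2%N \notin [pchar F].
Hypothesis abG : forall g h : G, (g * h)%g = (h * g)%g.
Implicit Types (T S : {fset G}) (t g h : G) (b beta : G -> G -> F).
Implicit Types (mu tau : G -> F) (D : grInvAlg F G).

Lemma elementary2_1 r T : elementary2_subgroup r T -> 1%g \in T.
Proof.
case=> f [fM _ fT]; apply/fT; exists 0; apply: (mulgI (f 0)).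
by rewrite -fM addr0 mulg1.
Qed.

Lemma elementary2_M r T g h :
  elementary2_subgroup r T -> g \in T -> h \in T -> (g * h)%g \in T.
Proof.
case=> f [fM _ fT] /fT[u <-] /fT[v <-]; apply/fT; exists (u + v); exact: fM.
Qed.

Lemma elementary2_sqr r T g : elementary2_subgroup r T -> g \in T -> (g * g)%g = 1%g.
Proof.
case=> f [fM _ fT] /fT[u <-]; rewrite -fM addmxF2; apply: (mulgI (f 0)).
by rewrite -fM addr0 mulg1.
Qed.

Lemma mem_adjoin T t g : (g \in adjoin T t) = (g \in T) || ((g * t^-1)%g \in T).
Proof.
rewrite in_fsetU; congr (_ || _); apply/imfsetP/idP=> [[u /= uT ->]|gT].
  by rewrite mulgK.
by exists (g * t^-1)%g; rewrite ?mulgVK.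
Qed.

Lemma sign_sqr (a : F) : a = 1 \/ a = -1 -> a * a = 1.
Proof. by case=> ->; rewrite ?mulrNN mulr1. Qed.

Section ExchangePauli.
Variables (r : nat) (T : {fset G}) (t : G) (beta : G -> G -> F) (tau : G -> F).
Variable D : grInvAlg F G.
Hypotheses (elT : elementary2_subgroup r T) (ord2 : has_order2 t) (tT : t \notin T).
Hypotheses (qT : quadratic_form T tau beta) (pD : pauli_graded T beta tau D).

Lemma tau_sqr g : g \in T -> tau g * tau g = 1.
Proof. by case: qT => q1 _ /q1; apply: sign_sqr. Qed.

Lemma tauM g h : g \in T -> h \in T -> tau (g * h)%g * beta g h = tau g * tau h.
Proof.
case: qT => _ q2 gT hT; rewrite q2 // -mulrA !mulrA tau_sqr ?mul1r //.
exact: elementary2_M elT gT hT.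
Qed.

Lemma Dinv_involution : is_involution (gia_inv D).
Proof. apply: (pauli_involution pD) => [g|g h]; [exact: tau_sqr|exact: tauM]. Qed.

Lemma beta_sqr g h : g \in T -> h \in T -> beta g h * beta g h = 1.
Proof.
move=> gT hT; case: qT => _ q2; have ghT := elementary2_M elT gT hT.
by rewrite q2 // mulrACA tau_sqr // mulr1 mulrACA !tau_sqr // mulr1.
Qed.

Lemma coset_notin g : g \in T -> (g * t)%g \notin T.
Proof. by move=> gT; rewrite -[t]expg1 (elementary2_coset true elT). Qed.

Lemma T_part_in g : g \in adjoin T t -> T_part T t g \in T.
Proof. by rewrite mem_adjoin /T_part; case: ifP. Qed.

Lemma tau_ext_sqr g : g \in adjoin T t -> tau_ext T t tau g * tau_ext T t tau g = 1.
Proof.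
rewrite mem_adjoin /tau_ext; case: ifP => [gT _|_ /= gT]; rewrite ?mulrNN tau_sqr //.
Qed.

Lemma tau_ext_part g : tau_ext T t tau g = (-1) ^+ (g \notin T) * tau (T_part T t g).
Proof. by rewrite /tau_ext /T_part; case: ifP; rewrite ?mul1r ?mulN1r. Qed.

(** At most one of [g] and [g * t] lies in [T], so the symmetric or the skew contribution vanishes
    and the rest is the graph of a scalar. *)
Lemma mem_gia_ex_pauli g (z : gia_ex t D) : z \in gia_gr (gia_ex t D) g <->
  z.1 \in gia_gr D (T_part T t g) /\ z.2 = tau_ext T t tau g *: (z.1 : D).
Proof.
have outT h x : h \notin T -> x \in gia_gr D h -> x = 0.
  by rewrite -(pauli_support pD) negbK => /eqP-> /[!memv0]/eqP.
have tV := order2V ord2.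
split=> [/(mem_gia_ex ord2)[x [y [xg yg ->]]]|].
  rewrite /= /T_part /tau_ext tV; case: ifP => gT.
    rewrite (outT _ _ (coset_notin gT) yg) addr0 subr0; split=> //.
    exact: (pauli_inv pD xg).
  rewrite (outT _ _ (negbT gT) xg) add0r sub0r; split=> //.
  by rewrite linearN /= (pauli_inv pD yg) scaleNr.
case: z => x y /= [xg ->]; apply/(mem_gia_ex ord2); move: xg.
rewrite /T_part /tau_ext tV; case: ifP => gT xg.
  by exists x, 0; rewrite mem0v addr0 subr0 (pauli_inv pD xg).
by exists 0, x; rewrite mem0v add0r sub0r linearN /= (pauli_inv pD xg) scaleNr.
Qed.

Lemma gia_ex_pauli :
  pauli_graded (adjoin T t) (beta_ext T t beta) (tau_ext T t tau) (gia_ex t D).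
Proof.
have supp g (x : D) : x \in gia_gr D (T_part T t g) -> x != 0 -> g \in adjoin T t.
  move=> /(pauli_supp pD)/[apply]; rewrite mem_adjoin /T_part.
  by case: ifP.
have z0 g (z : gia_ex t D) : z \in gia_gr (gia_ex t D) g -> z != 0 -> z.1 != 0.
  move=> /mem_gia_ex_pauli[_ z2]; apply: contraNneq => z1.
  by case: z z2 z1 => x y /= -> ->; rewrite scaler0.
have e0 g : g \in adjoin T t -> tau_ext T t tau g != 0.
  move=> gS; apply/eqP=> e0; have := tau_ext_sqr gS.
  by rewrite e0 mul0r => /esym/eqP; rewrite oner_eq0.
split.
- apply: gia_ex_grading (pauli_grading pD) Dinv_involution => //.
- move=> g z zg nz; have /mem_gia_ex_pauli[z1 z2] := zg.
  have n1 := z0 _ _ zg nz; have u1 := pauli_unit pD z1 n1.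
  have gS := supp _ _ z1 n1.
  apply/andP; split=> //; rewrite z2.
  by rewrite -[_ \is a _]/((_ : D) \is a GRing.unit) scaler_unit ?unitfE ?e0.
- move=> g; apply/idP/idP => [g0|gS].
    have /mem_gia_ex_pauli[z1 _] := memv_pick (gia_gr (gia_ex t D) g).
    apply: supp z1 _; apply: z0 (memv_pick _) _; by rewrite vpick0.
  have [x xg x0] := pauli_ex pD (T_part_in gS).
  have xz : ((x, tau_ext T t tau g *: x) : gia_ex t D) \in gia_gr (gia_ex t D) g.
    exact/mem_gia_ex_pauli.
  apply: contraNneq x0 => g0; move: xz; rewrite g0 memv0 => /eqP[-> _].
  by [].
- move=> g gS; have [x xg x0] := pauli_ex pD (T_part_in gS).
  pose z : gia_ex t D := (x, tau_ext T t tau g *: x).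
  have -> : gia_gr (gia_ex t D) g = <[z]>%VS.
    apply/vspaceP=> w; apply/idP/vlineP=> [/mem_gia_ex_pauli[w1 w2]|[a ->]].
      have [a Da] := pauli_lineP pD xg x0 w1; exists a.
      case: w w1 w2 Da => w1 w2 /= _ -> ->; congr (_, _).
      by rewrite -[RHS]/(_ : D) !scalerA mulrC.
    by apply: memvZ; apply/mem_gia_ex_pauli.
  by rewrite dim_vline; have -> : z != 0 by apply: contraNneq x0 => -[->].
- move=> g h [x x'] [y y'] /mem_gia_ex_pauli[/= xg ->] /mem_gia_ex_pauli[/= yh ->].
  have [->|x0] := eqVneq x 0; first by rewrite scaler0 !(mul0r, mulr0) scaler0.
  have [->|y0] := eqVneq y 0; first by rewrite scaler0 !(mul0r, mulr0) scaler0.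
  have pg := pauli_supp pD xg x0; have ph := pauli_supp pD yh y0.
  rewrite /beta_ext; congr (_, _); first exact: (pauli_comm pD xg yh).
  (* The second coordinate multiplies in reverse order, so its commutation factor is inverse to
     [beta], and [beta] has square 1. *)
  rewrite -[LHS]/((_ *: y) * (_ *: x)) -[RHS]/(_ *: ((_ *: x) * (_ *: y)) : D).
  rewrite -!scalerAl -!scalerAr !scalerA (pauli_comm pD xg yh) scalerA.
  congr (_ *: _).
  by rewrite [RHS]mulrC !mulrA beta_sqr // mul1r mulrC.
- move=> g [x x'] /mem_gia_ex_pauli[/= xg ->]; rewrite lfunE /=.
  have [->|x0] := eqVneq x 0; first by rewrite !scaler0.
  congr (_, _); rewrite -[RHS]/(_ *: (_ *: x) : D) scalerA tau_ext_sqr ?scale1r //.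
  exact: supp xg x0.
Qed.

End ExchangePauli.
End Datum.

(** * Uniqueness of Pauli gradings *)

Lemma closed_sqrt (F : closedFieldType) (a : F) : exists c, c * c = a.
Proof.
have /closed_rootP[c] : size ('X^2 - a%:P) != 1%N by rewrite size_XnsubC.
by rewrite /root !hornerE subr_eq0 => /eqP <-; exists c.
Qed.

(** Directness alone is assumed, since [exists_Dinv] applies this before its family is known to be a
    grading. *)
Lemma graded_free (F : fieldType) (G : groupType) (A : falgType F)
    (Gamma : G -> {vspace A}) (w : G -> A) (s : seq G) :
    (forall (s : seq G) (y : G -> A), uniq s -> (forall g, y g \in Gamma g) ->
       \sum_(g <- s) y g = 0 -> {in s, forall g, y g = 0}) ->
    uniq s -> {in s, forall g, w g \in Gamma g} ->
    {in s, forall g, w g != 0} ->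
  free [seq w g | g <- s].
Proof.
move=> dir; elim: s => [|g s IHs] /=; first by rewrite nil_free.
case/andP=> gs us wG w0; rewrite free_cons {}IHs ?andbT //; first last.
- by move=> h hs; apply: w0; rewrite inE hs orbT.
- by move=> h hs; apply: wG; rewrite inE hs orbT.
apply/negP; rewrite span_def big_map => /(memv_sum_seqP us)[y yw Dw].
have /eqP := w0 g (mem_head _ _); apply.
have := dir (g :: s) (fun h => if h == g then w g else if h \in s then - y h else 0).
move/(_ _ _ _ g); rewrite eqxx mem_head; apply=> //=.
- by rewrite gs.
- move=> h; case: eqP => [->|_]; first by apply: wG; rewrite mem_head.
  case: ifP => hs; last exact: mem0v.
  rewrite memvN; apply: (subvP _ _ (yw h)).
  by rewrite -memvE wG // inE hs orbT.
rewrite big_cons eqxx {1}Dw -big_split big1_seq //= => h hs.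
rewrite hs; case: eqP gs => [<-|_ _]; last by rewrite subrr.
by rewrite hs.
Qed.

Section Isomorphism.
Variables (F : closedFieldType) (G : groupType).
Variables (S : {fset G}) (b : G -> G -> F) (mu : G -> F) (r : nat).
Hypothesis elS : elementary2_subgroup r S.

Lemma pauli_span (E : grInvAlg F G) (w : G -> E) :
    pauli_graded S b mu E -> {in S, forall g, w g \in gia_gr E g} ->
    {in S, forall g, w g != 0} ->
  <<[seq w g | g <- S]>>%VS = {:E}%VS.
Proof.
move=> pE wE w0; apply/eqP; rewrite eqEsubv subvf /=; apply/subvP=> x _.
elim/(graded_ind (pauli_grading pE)): x => [|x y Ex Ey|g x xg].
- exact: mem0v.
- exact: memvD.
have [->|x0] := eqVneq x 0; first exact: mem0v.
have gS := pauli_supp pE xg x0.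
have [a ->] := pauli_lineP pE (wE g gS) (w0 g gS) xg.
by apply/memvZ/memv_span/map_f.
Qed.

Section CommonBasis.
Variables E1 E2 : grInvAlg F G.
Hypotheses (p1 : pauli_graded S b mu E1) (p2 : pauli_graded S b mu E2).
Local Notation A1 := (gia_alg E1).
Local Notation A2 := (gia_alg E2).

Let homog g (z : A1 * A2) := z.1 \in gia_gr E1 g /\ z.2 \in gia_gr E2 g.

Let homogM g h z w : homog g z -> homog h w -> homog (g * h)%g (z * w).
Proof.
case=> z1 z2 [w1 w2].
by split; [apply: (graded_mul (pauli_grading p1)) | apply: (graded_mul (pauli_grading p2))].
Qed.

Let homog_comm g h z w : homog g z -> homog h w -> z * w = b g h *: (w * z).
Proof.
case: z w => z1 z2 [w1 w2] [/= z1g z2g] [/= w1h w2h].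
by congr (_, _); [apply: (pauli_comm p1) | apply: (pauli_comm p2)].
Qed.

Let homog1 : homog 1%g 1.
Proof. by split; apply: graded_one; [apply: pauli_grading p1 | apply: pauli_grading p2]. Qed.

(** The square of a nonzero element of degree [g] has degree 1, hence is a nonzero scalar; dividing
    by a square root of that scalar normalizes it. *)
Lemma pauli_square_root (E : grInvAlg F G) g : pauli_graded S b mu E -> g \in S ->
  exists2 x, x \in gia_gr E g & x * x = 1.
Proof.
move=> pE gS; have [x xg x0] := pauli_ex pE gS.
have := graded_mul (pauli_grading pE) xg xg; rewrite (elementary2_sqr elS gS).
have one := graded_one (pauli_grading pE).
case/(pauli_lineP pE one (oner_neq0 _)) => a Da; have [c Dc] := closed_sqrt a.
have c0 : c != 0.
  apply: contraNneq (pauli_mul_neq0 pE xg xg x0 x0) => c0.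
  by rewrite Da -Dc c0 mul0r scale0r.
exists (c^-1 *: x); first exact: memvZ.
by rewrite -scalerAl -scalerAr Da !scalerA -Dc mulrACA mulVf // mul1r scale1r.
Qed.

(** Working in the product algebra makes the structure constants [c] common to the two
    coordinates. *)
Lemma common_basis : exists W : G -> A1 * A2,
  [/\ {in S, forall g, (W g).1 \in gia_gr E1 g},
      {in S, forall g, (W g).2 \in gia_gr E2 g},
      {in S, forall g, (W g).1 != 0 /\ (W g).2 != 0},
      W 1%g = 1
    & {in S &, forall g h, exists c, W g * W h = c *: W (g * h)%g}].
Proof.
have [f [fM f_inj fS]] := elS.
have f0 : f 0 = 1%g by apply: (mulgI (f 0)); rewrite -fM addr0 mulg1.
have /fin_all_exists2[a aE aa] (i : 'I_r) :
    exists2 z : A1 * A2, homog (f (delta_mx 0 i)) z & z * z = 1.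
  have iS : f (delta_mx 0 i) \in S by apply/fS; exists (delta_mx 0 i).
  have [x xE xx] := pauli_square_root p1 iS.
  have [y yE yy] := pauli_square_root p2 iS.
  by exists (x, y); rewrite // -[LHS]/(x * x, y * y) xx yy.
have apE i (k : 'F_2) : homog (f (k *: delta_mx 0 i)) (a i ^+ k).
  by case: (F2_cases k) => ->; rewrite ?scale0r ?scale1r ?f0 ?expr0 ?expr1.
(* Exponents in ['F_2] are read as 0 or 1; they add modulo 2 because [a i] has square 1. *)
have apD i (k l : 'F_2) : a i ^+ k * a i ^+ l = a i ^+ (k + l)%R.
  case: (F2_cases k) => ->; first by rewrite expr0 mul1r add0r.
  case: (F2_cases l) => ->; first by rewrite expr0 mulr1 addr0.
  by rewrite expr1 aa.
pose w s (u : 'rV['F_2]_r) := \prod_(i <- s) a i ^+ (u 0 i).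
have w_cons i s u : w (i :: s) u = a i ^+ (u 0 i) * w s u by rewrite /w big_cons.
have wE s (u : 'rV_r) : homog (f (\sum_(i <- s) u 0 i *: delta_mx 0 i)) (w s u).
  elim: s => [|i s IHs]; first by rewrite /w !big_nil f0.
  by rewrite w_cons big_cons fM; apply: homogM.
(* Reordering the product [w s u * w s v] only introduces values of [b]. *)
have wM s (u v : 'rV_r) : exists c, w s u * w s v = c *: w s (u + v).
  elim: s => [|i s [c Dc]]; first by exists 1; rewrite /w !big_nil mul1r scale1r.
  rewrite !w_cons mxE -apD mulrA -(mulrA (a i ^+ _)).
  rewrite (homog_comm (wE s u) (apE i (v 0 i))) -scalerAr -scalerAl.
  by rewrite !mulrA -(mulrA _ (w s u)) Dc -scalerAr scalerA; eexists.
(* A left inverse of [f], equal to 0 off its image. *)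
pose finv g := odflt 0 [pick u | f u == g].
have fK u : finv (f u) = u.
  by rewrite /finv; case: pickP => [v /eqP/f_inj|/(_ u)/eqP].
pose W g := w (index_enum 'I_r) (finv g).
have WE g : g \in S -> homog g (W g).
  by move=> /fS[u <-]; rewrite /W fK {1}[u]row_sum_delta.
have WM : {in S &, forall g h, exists c, W g * W h = c *: W (g * h)%g}.
  by move=> _ _ /fS[u <-] /fS[v <-]; rewrite -fM /W !fK.
have W1 : W 1%g = 1.
  by rewrite /W -f0 fK /w big1 // => i _; rewrite mxE expr0.
exists W; split=> // g gS; try by have [] := WE g gS.
have aU i : a i \is a GRing.unit by apply/unitrP; exists (a i); rewrite aa.
have : W g \is a GRing.unit by apply: rpred_prod => i _; apply: rpredX; apply: aU.
by case/andP=> U1 U2; split; [move: U1 | move: U2];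
  apply: contraTneq => ->; rewrite unitr0.
Qed.

Lemma pauli_iso : gia_iso E1 E2.
Proof.
have [W [W1 W2 W0 W_1 WM]] := common_basis.
pose X := [seq (W g).1 | g <- S]; pose Y := [seq (W g).2 | g <- S].
have spanX : <<X>>%VS = fullv.
  by apply: pauli_span p1 W1 _ => g /W0[].
have spanY : <<Y>>%VS = fullv.
  by apply: pauli_span p2 W2 _ => g /W0[].
have freeX : free X.
  have [_ dir _] := pauli_grading p1.
  by apply: (graded_free dir (fset_uniq S) W1) => g /W0[].
have freeY : free Y.
  have [_ dir _] := pauli_grading p2.
  by apply: (graded_free dir (fset_uniq S) W2) => g /W0[].
have [f0 mapf] := linear_of_free X Y; have [h0 maph] := linear_of_free Y X.
have {}mapf := mapf freeX (etrans (size_map _ _) (esym (size_map _ _))).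
have {}maph := maph freeY (etrans (size_map _ _) (esym (size_map _ _))).
pose f : 'Hom(A1, A2) := linfun f0; pose h : 'Hom(A2, A1) := linfun h0.
have fW g : g \in S -> f (W g).1 = (W g).2.
  by move=> gS; rewrite lfunE; move: mapf; rewrite -map_comp => /eq_in_map/(_ g gS).
have hW g : g \in S -> h (W g).2 = (W g).1.
  by move=> gS; rewrite lfunE; move: maph; rewrite -map_comp => /eq_in_map/(_ g gS).
have fK : cancel f h.
  move=> x; rewrite -comp_lfunE -[RHS]id_lfunE; congr (fun_of_lfun _ x).
  apply/(fullv_lfunP _ _ spanX) => _ /mapP[g gS ->].
  by rewrite comp_lfunE id_lfunE fW ?hW.
have hK : cancel h f.
  move=> x; rewrite -comp_lfunE -[RHS]id_lfunE; congr (fun_of_lfun _ x).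
  apply/(fullv_lfunP _ _ spanY) => _ /mapP[g gS ->].
  by rewrite comp_lfunE id_lfunE hW ?fW.
have line1 g x : x \in gia_gr E1 g -> x != 0 -> exists a, x = a *: (W g).1.
  move=> xg x0; have gS := pauli_supp p1 xg x0; have [n1 _] := W0 g gS.
  exact: (pauli_lineP p1 (W1 g gS) n1).
have fM x y : f (x * y) = f x * f y.
  elim/(graded_ind (pauli_grading p1)): x => [|x x' Ex Ex'|g x xg].
  - by rewrite mul0r linear0 mul0r.
  - by rewrite mulrDl !linearD /= Ex Ex' mulrDl.
  elim/(graded_ind (pauli_grading p1)): y => [|y y' Ey Ey'|k y yk].
  - by rewrite mulr0 linear0 mulr0.
  - by rewrite mulrDr !linearD /= Ey Ey' mulrDr.
  have [->|x0] := eqVneq x 0; first by rewrite mul0r linear0 mul0r.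
  have [->|y0] := eqVneq y 0; first by rewrite mulr0 linear0 mulr0.
  have gS := pauli_supp p1 xg x0; have kS := pauli_supp p1 yk y0.
  have [a ->] := line1 g x xg x0; have [c ->] := line1 k y yk y0.
  (* The same [e] governs both coordinates, so [f] respects products. *)
  have [e De] := WM g k gS kS.
  have De1 : (W g).1 * (W k).1 = e *: (W (g * k)%g).1 := congr1 fst De.
  have De2 : (W g).2 * (W k).2 = e *: (W (g * k)%g).2 := congr1 snd De.
  rewrite -!scalerAl -!scalerAr De1 !linearZ /= !fW //.
    by rewrite -!scalerAl -!scalerAr De2.
  exact: (pauli_suppM p1).
have f1 : f 1 = 1.
  by have := fW 1%g (pauli_supp1 p1); rewrite W_1.
have f_ahom : ahom_in {:A1} f by apply/ahom_inP; split=> // x y _ _; apply: fM.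
exists (AHom f_ahom); split=> /= [|x|g]; first by exists h.
  elim/(graded_ind (pauli_grading p1)): x => [|x x' Ex Ex'|g x xg].
  - by rewrite !linear0.
  - by rewrite !linearD /= Ex Ex'.
  have [->|x0] := eqVneq x 0; first by rewrite !linear0.
  rewrite (pauli_inv p1 xg) linearZ /=; have [a ->] := line1 g x xg x0.
  have gS := pauli_supp p1 xg x0.
  by rewrite !linearZ /= fW // (pauli_inv p2 (W2 g gS)).
have [gS|gS] := boolP (g \in S); last first.
  have := pauli_support p1 g; have := pauli_support p2 g.
  by rewrite (negbTE gS) => /negbFE/eqP-> /negbFE/eqP->; rewrite limg0.
have [n1 n2] := W0 g gS.
by rewrite (pauli_line p1 (W1 g gS) n1) (pauli_line p2 (W2 g gS) n2) limg_line fW.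
Qed.

End CommonBasis.
End Isomorphism.

(** * The exchange algebras of the theorem *)

Section Groups.
Variables (G : groupType).
Hypothesis abG : forall g h : G, (g * h)%g = (h * g)%g.

Lemma adjoin_elementary2 r (T : {fset G}) t :
    elementary2_subgroup r T -> has_order2 t -> t \notin T ->
  elementary2_subgroup (r + 1) (adjoin T t).
Proof.
move=> elT ord2 tT; have tV := order2V ord2; have [_ t2] := ord2.
have [f [fM f_inj fT]] := elT.
have f0 : f 0 = 1%g by apply: (mulgI (f 0)); rewrite -fM addr0 mulg1.
have tD (k l : 'F_2) : (t ^+ (k + l)%R = t ^+ k * t ^+ l)%g.
  case: (F2_cases k) => ->; first by rewrite add0r expg0 mul1g.
  case: (F2_cases l) => ->; first by rewrite addr0 expg0 mulg1.
  by rewrite !expg1 t2.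
(* The extra coordinate is the exponent of [t]. *)
pose f' (u : 'rV['F_2]_(r + 1)) := (f (lsubmx u) * t ^+ (rsubmx u 0%R 0%R))%g.
have f'M u v : (f' (u + v) = f' u * f' v)%g.
  rewrite /f' !linearD /= mxE fM tD -!mulgA; congr (_ * _)%g.
  by rewrite !mulgA (abG (t ^+ _)%g).
have f'0 u : f' u = 1%g -> u = 0.
  rewrite /f' => Du; rewrite -[LHS]hsubmxK -row_mx0; move: Du.
  case: (F2_cases (rsubmx u 0 0)) => Du; rewrite Du.
    rewrite expg0 mulg1 -f0 => /f_inj->; congr row_mx.
    by apply/rowP=> i; rewrite ord1 Du mxE.
  rewrite expg1 => /mulg1_eq/(congr1 (fun x => x^-1)%g); rewrite invgK tV => Dt.
  by case/negP: tT; apply/fT; exists (lsubmx u).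
exists f'; split=> // [u v uv|g].
  apply/eqP; rewrite -subr_eq0; apply/eqP/f'0/(mulIg (f' v)).
  by rewrite -f'M subrK mul1g.
rewrite mem_adjoin tV; split=> [/orP[/fT[u <-]|/fT[u Du]]|[u <-]].
- by exists (row_mx u 0); rewrite /f' row_mxKl row_mxKr mxE expg0 mulg1.
- exists (row_mx u (const_mx 1)); rewrite /f' row_mxKl row_mxKr mxE expg1 Du.
  by rewrite -mulgA t2 mulg1.
have uT : f (lsubmx u) \in T by apply/fT; exists (lsubmx u).
rewrite /f'; case: (F2_cases (rsubmx u 0 0)) => ->.
  by rewrite expg0 mulg1 uT.
by rewrite expg1 -mulgA t2 mulg1 uT orbT.
Qed.

End Groups.

Section ExchangeDatum.
Variables (F : fieldType) (G : groupType).
Hypothesis charF : 2%N \notin [pchar F].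
Hypothesis abG : forall g h : G, (g * h)%g = (h * g)%g.
Variables (m : nat) (T : {fset G}) (t : G) (beta : G -> G -> F) (tau : G -> F).
Hypothesis dat : ex_datum m T t beta tau.

Let elT : elementary2_subgroup (2 * m) T. Proof. by case: dat. Qed.
Let ord2 : has_order2 t. Proof. by case: dat. Qed.
Let tT : t \notin T. Proof. by case: dat. Qed.
Let qT : quadratic_form T tau beta. Proof. by case: dat. Qed.
Let ndT : Defs.nondegenerate T beta. Proof. by case: dat => _ _ _ _ []. Qed.

Lemma beta_sym g h : g \in T -> h \in T -> beta g h = beta h g.
Proof. by case: qT => _ q2 gT hT; rewrite !q2 // abG mulrAC. Qed.

(** Otherwise [g * h], which is [g * h^-1] in an elementary 2-group, would lie in the radical of
    [beta]. *)
Lemma beta_separates g h : g \in T -> h \in T -> g != h ->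
  exists2 u, u \in T & beta u g != beta u h.
Proof.
move=> gT hT gh; apply/hasP; apply: contraR gh => /hasPn eq_b.
have ghT := elementary2_M elT gT hT.
have [_ bM _] : bicharacter T beta by case: dat => _ _ _ _ [].
apply/eqP; apply: (mulIg h); rewrite (elementary2_sqr elT hT).
apply: ndT => // u uT; rewrite bM // !(beta_sym _ uT) //.
have /eqP-> : beta u g == beta u h by have := eq_b u uT; rewrite negbK.
exact: (beta_sqr elT qT).
Qed.

Lemma Dinv_pauli D : is_Dinv T beta tau D -> pauli_graded T beta tau D.
Proof.
case=> [[[_ gr div] [supp dim1 comm]] inv].
have in_supp g (x : D) : x \in gia_gr D g -> x != 0 -> g \in T.
  move=> xg; apply: contraNT; rewrite -supp negbK => /eqP g0.
  by rewrite g0 memv0 in xg.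
split=> // [g h x y xg yh|g x xg].
  have [->|x0] := eqVneq x 0; first by rewrite mul0r mulr0 scaler0.
  have [->|y0] := eqVneq y 0; first by rewrite mul0r mulr0 scaler0.
  by apply: (comm g h); rewrite // ?(in_supp _ _ xg x0) ?(in_supp _ _ yh y0).
have [->|x0] := eqVneq x 0; first by rewrite linear0 scaler0.
by apply: (inv g); rewrite // (in_supp _ _ xg x0).
Qed.

Lemma Dinv_ex_pauli D : is_Dinv T beta tau D ->
  pauli_graded (adjoin T t) (beta_ext T t beta) (tau_ext T t tau) (gia_ex t D).
Proof. by move=> /Dinv_pauli; apply: gia_ex_pauli elT ord2 tT qT. Qed.

(** The extended form depends on [T]-parts only and [beta] is nondegenerate, so its radical consists
    of the elements with trivial [T]-part. This recovers [t] from the form. *)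
Lemma adjoin_radical g : g \in adjoin T t ->
  {in adjoin T t, forall h, beta_ext T t beta g h = 1} <-> (g = 1 \/ g = t)%g.
Proof.
move=> gS; have := T_part_in gS.
have T1 := elementary2_1 elT.
have p1 : T_part T t g = 1%g <-> (g = 1 \/ g = t)%g.
  rewrite /T_part; split=> [|[]->]; last 2 first.
  - by rewrite T1.
  - by rewrite (negbTE tT) mulgV.
  by case: ifP => _; [left | move=> /divg1_eq; right].
move=> pT; split=> [rad|].
  apply/p1; apply: ndT => // u uT; have := rad u; rewrite mem_adjoin uT.
  by rewrite /beta_ext [X in beta _ X]/T_part uT; apply.
move=> /p1 g1 h hS; rewrite /beta_ext g1.
have [b0 bM _] : bicharacter T beta by case: dat => _ _ _ _ [].
have hT := T_part_in hS.
by apply: (mulfI (b0 _ _ T1 hT)); rewrite -bM // mulg1 mulr1.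
Qed.

Lemma gia_ex_division_simple D : is_Dinv T beta tau D ->
  graded_division_simple_inv (gia_ex t D).
Proof.
move=> Di; have pE := Dinv_ex_pauli Di; have pD := Dinv_pauli Di.
split; [exact: pauli_grading pE | exact: pauli_division pE | | |].
- exact: gia_ex_involution.
- exact: pauli_inv_stable pE.
move=> I idI stI; have [->|I0] := eqVneq I 0%VS; [by left | right].
apply: (pauli_ideal pE idI I0) => g h gS hS gh.
have [pgh|pgh] := eqVneq (T_part T t g) (T_part T t h); last first.
  have [u uT bu] := beta_separates (T_part_in gS) (T_part_in hS) pgh.
  left; exists u; first by rewrite mem_adjoin uT.
  by rewrite /beta_ext [X in beta X _]/T_part [X in _ != beta X _]/T_part uT.
(* Distinct degrees with equal [T]-part differ by [t]; the extended [tau] takes opposite values on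
   them, distinct as 2 is nonzero. *)
right; split=> //; rewrite !tau_ext_part pgh.
have n0 : tau (T_part T t h) != 0.
  apply/eqP=> e0; have := tau_sqr qT (T_part_in hS).
  by rewrite e0 mul0r => /esym/eqP; rewrite oner_eq0.
move: pgh gh; rewrite /T_part.
have one : (1 : F) != -1 by rewrite -subr_eq0 opprK (two_neq0 charF).
rewrite (inj_eq (mulIf n0)).
case: ifP => gT; case: ifP => hT /=; rewrite ?expr0 ?expr1 //.
- by move=> ->; rewrite eqxx.
- by rewrite [in X in _ -> _ -> X]eq_sym.
- by move=> /mulIg->; rewrite eqxx.
Qed.

End ExchangeDatum.

Lemma eq_pauli (F : fieldType) (G : groupType) (S : {fset G}) (b b' : G -> G -> F)
    (mu mu' : G -> F) (E : grInvAlg F G) :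
    {in S &, b =2 b'} -> {in S, mu =1 mu'} ->
  pauli_graded S b mu E -> pauli_graded S b' mu' E.
Proof.
move=> eb emu pE; have supp := pauli_supp pE.
case: (pE) => gr div sup dim1 comm inv; split=> // [g h x y xg yh|g x xg].
  have [->|x0] := eqVneq x 0; first by rewrite mul0r mulr0 scaler0.
  have [->|y0] := eqVneq y 0; first by rewrite mul0r mulr0 scaler0.
  by rewrite -eb ?(supp _ _ xg x0) ?(supp _ _ yh y0) //; apply: comm.
have [->|x0] := eqVneq x 0; first by rewrite linear0 scaler0.
by rewrite -emu ?(supp _ _ xg x0) //; apply: inv.
Qed.

(** Support, form and signs are invariants by [pauli_gia_iso]; then [t1] is a nontrivial radical
    element of the second form, hence [t2]. Conversely [pauli_iso] builds the isomorphism from equal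
    data. *)
Lemma ex_iso_iff (F : closedFieldType) (G : groupType)
    (abG : forall g h : G, (g * h)%g = (h * g)%g)
    (charF : 2%N \notin [pchar F]) (m1 m2 : nat) (T1 T2 : {fset G}) (t1 t2 : G)
    (beta1 beta2 : G -> G -> F) (tau1 tau2 : G -> F) (D1 D2 : grInvAlg F G) :
    ex_datum m1 T1 t1 beta1 tau1 -> ex_datum m2 T2 t2 beta2 tau2 ->
    is_Dinv T1 beta1 tau1 D1 -> is_Dinv T2 beta2 tau2 D2 ->
  gia_iso (gia_ex t1 D1) (gia_ex t2 D2) <->
  [/\ adjoin T1 t1 = adjoin T2 t2,
      t1 = t2,
      {in adjoin T1 t1 &, beta_ext T1 t1 beta1 =2 beta_ext T2 t2 beta2}
    & {in adjoin T1 t1, tau_ext T1 t1 tau1 =1 tau_ext T2 t2 tau2}].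
Proof.
move=> dat1 dat2 Di1 Di2.
have p1 := Dinv_ex_pauli charF abG dat1 Di1.
have p2 := Dinv_ex_pauli charF abG dat2 Di2.
have [elT1 ord1 tT1 _ _] := dat1.
split=> [iso|[eS et eb emu]].
  have [eS eb emu] := pauli_gia_iso p1 p2 iso; split=> //.
  have t1S : t1 \in adjoin T1 t1 by rewrite mem_adjoin mulgV (elementary2_1 elT1) orbT.
  have t1S2 : t1 \in adjoin T2 t2 by rewrite -eS.
  have [t11|//] : (t1 = 1 \/ t1 = t2)%g; last by case: ord1; rewrite t11 eqxx.
  apply/(adjoin_radical dat2 t1S2) => h; rewrite -eS => hS; rewrite -eb //.
  by move: h hS; apply/(adjoin_radical dat1 t1S); right.
apply: (pauli_iso (adjoin_elementary2 abG elT1 ord1 tT1) p1).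
have eb' : {in adjoin T2 t2 &, beta_ext T2 t2 beta2 =2 beta_ext T1 t1 beta1}.
  by rewrite -eS => g h gS hS; rewrite eb.
have emu' : {in adjoin T2 t2, tau_ext T2 t2 tau2 =1 tau_ext T1 t1 tau1}.
  by rewrite -eS => g gS; rewrite emu.
by rewrite eS; apply: eq_pauli eb' emu' p2.
Qed.

(** * Symplectic bases over 'F_2 *)

(** Writing a form as [L + L^T] expresses that it is alternating: the two terms are transposes of
    one 1 by 1 matrix and cancel over ['F_2]. *)
Lemma form_vanishes n (L : 'M['F_2]_n) (v : 'rV_n) : v *m (L + L^T) *m v^T = 0.
Proof.
rewrite mulmxDr mulmxDl.
have -> : v *m L^T *m v^T = (v *m L *m v^T)^T by rewrite !trmx_mul trmxK mulmxA.
rewrite (_ : (v *m L *m v^T)^T = v *m L *m v^T) ?addmxF2 //.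
by apply/matrixP=> i j; rewrite !mxE !ord1.
Qed.

(** Take [W] isotropic of maximal rank [k]. Its orthogonal [K] has dimension [n - k] and contains
    [W]; a vector of [K] outside [W] would extend [W], so [K = W] and [n - k = k]. *)
Lemma maximal_isotropic n (B L : 'M['F_2]_n) : B = L + L^T -> B \in unitmx ->
  exists k (W : 'M['F_2]_(k, n)), [/\ n = (k + k)%N, row_free W & W *m B *m W^T = 0].
Proof.
move=> DB uB.
have Bsym : B^T = B by rewrite DB linearD /= trmxK addrC.
pose P k := [exists W : 'M['F_2]_(k, n), row_free W && (W *m B *m W^T == 0)].
have exP : exists k, P k.
  exists 0%N; apply/existsP; exists 0.
  by rewrite /row_free mxrank0 /= mul0mx mul0mx.
have ubP k : P k -> (k <= n)%N.
  by case/existsP=> W /andP[/eqP rW _]; rewrite -rW rank_leq_col.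
case: (ex_maxnP exP ubP) => k /existsP[W /andP[freeW /eqP isoW]] maxk.
exists k, W; split=> //.
pose K := kermx (B *m W^T).
have rK : \rank K = (n - k)%N.
  rewrite mxrank_ker -mxrank_tr trmx_mul trmxK Bsym mxrankMfree ?row_free_unit //.
  by rewrite (eqP freeW).
have WK : (W <= K)%MS by apply/sub_kermxP; rewrite mulmxA.
have lek := mxrankS WK; rewrite (eqP freeW) rK in lek.
have kln : (k <= n)%N by rewrite -(eqP freeW) rank_leq_col.
suff KW : (K <= W)%MS.
  have := mxrankS KW; rewrite rK (eqP freeW) => lek'.
  by rewrite -{1}(subnK kln); congr (_ + _)%N; apply/eqP; rewrite eqn_leq lek lek'.
apply: contraT => /row_subPn[i].
have : (row i K <= K)%MS by apply: row_sub.
move/sub_kermxP; move: (row i K) => v vB vW.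
have : (k.+1 <= k)%N; last by rewrite ltnn.
rewrite -addn1; apply: maxk; apply/existsP; exists (col_mx W v); apply/andP; split.
  rewrite /row_free eqn_leq rank_leq_row /= [X in (X <= _)%N]addn1.
  have : (W < W + v)%MS by rewrite ltmxE addsmxSl addsmx_sub submx_refl.
  by rewrite ltmxErank => /andP[_]; rewrite addsmxE (eqP freeW).
rewrite mul_col_mx tr_col_mx mul_col_row isoW -[v *m B *m W^T]mulmxA vB.
rewrite {2}DB form_vanishes.
have -> : W *m B *m v^T = 0 by apply: trmx_inj; rewrite !trmx_mul trmxK Bsym vB trmx0.
by rewrite block_mx0.
Qed.

(** The rows of [U] are dual to the isotropic rows of [W], and [V = U + M W] makes them isotropic.
    As 2 is not invertible, half of the Gram matrix of [U] is replaced by [M], for which [M + M^T]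
    is that matrix. *)
Lemma symplectic_basis n (B L : 'M['F_2]_n) : B = L + L^T -> B \in unitmx ->
  exists k (P : 'M['F_2]_(k + k, n)),
    n = (k + k)%N /\ P *m B *m P^T = block_mx 0 1%:M 1%:M 0.
Proof.
move=> DB uB; have [k [W [Dn freeW isoW]]] := maximal_isotropic DB uB.
have Bsym : B^T = B by rewrite DB linearD /= trmxK addrC.
exists k; have freeWB : row_free (W *m B).
  by rewrite /row_free mxrankMfree ?row_free_unit.
pose U := (pinvmx (W *m B))^T.
have WU : W *m B *m U^T = 1%:M by rewrite trmxK mulmxVp.
have UW : U *m B *m W^T = 1%:M.
  by apply: trmx_inj; rewrite !trmx_mul trmxK Bsym mulmxA WU trmx1.
pose M := U *m L *m U^T.
have UU : U *m B *m U^T = M + M^T.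
  by rewrite {1}DB mulmxDr mulmxDl /M !trmx_mul trmxK mulmxA.
pose V := U + M *m W.
have WV : W *m B *m V^T = 1%:M.
  by rewrite linearD /= trmx_mul mulmxDr WU mulmxA isoW mul0mx addr0.
have VW : V *m B *m W^T = 1%:M.
  by apply: trmx_inj; rewrite !trmx_mul trmxK Bsym mulmxA WV trmx1.
have UV : U *m B *m V^T = M.
  by rewrite linearD /= trmx_mul mulmxDr UU mulmxA UW mul1mx -addrA addmxF2 addr0.
have VV : V *m B *m V^T = 0.
  by rewrite {1}/V !mulmxDl UV -(mulmxA M W) -(mulmxA M) WV mulmx1 addmxF2.
exists (col_mx W V); split=> //.
by rewrite mul_col_mx tr_col_mx mul_col_row isoW WV VW VV.
Qed.

Section Sign.
Variable F : fieldType.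

Definition sign_char (x : 'F_2) : F := (-1) ^+ x.

Lemma sign_char0 : sign_char 0 = 1. Proof. by []. Qed.

Lemma sign_charD x y : sign_char (x + y) = sign_char x * sign_char y.
Proof.
rewrite /sign_char; case: (F2_cases x) => ->; first by rewrite add0r mul1r.
by case: (F2_cases y) => ->; rewrite ?addr0 ?mulr1 // mulrNN mulr1.
Qed.

Lemma sign_char_coord n (g : 'rV['F_2]_n -> F) (e : 'I_n -> 'F_2) u :
    (forall u v, g (u + v) = g u * g v) -> g 0 = 1 ->
    (forall i, g (delta_mx 0 i) = sign_char (e i)) ->
  g u = sign_char (\sum_i u 0 i * e i).
Proof.
move=> gD g0 ge; rewrite {1}[u]row_sum_delta.
rewrite (big_morph g gD g0) (big_morph _ sign_charD sign_char0).
apply: eq_bigr => i _; case: (F2_cases (u 0 i)) => ->.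
  by rewrite scale0r mul0r g0.
by rewrite scale1r mul1r ge.
Qed.

End Sign.

(** Gram matrix of the standard symplectic form on pairs [(q, p)]. *)
Definition hyperbolic k : 'M['F_2]_(k + k) := block_mx 0 1%:M 1%:M 0.

(** As [beta] has square 1, its exponents on a basis of [T] form a matrix over ['F_2], alternating
    and invertible; a symplectic basis for it gives [h] and forces the rank of [T] to be even. *)
Lemma symplectic_coordinates (F : fieldType) (G : groupType)
    (charF : 2%N \notin [pchar F]) n (T : {fset G}) (beta : G -> G -> F) tau :
    elementary2_subgroup n T -> quadratic_form T tau beta ->
    [/\ bicharacter T beta, alternating T beta & Defs.nondegenerate T beta] ->
  exists k (h : 'rV['F_2]_(k + k) -> G), n = (k + k)%N /\
    [/\ forall u v, h (u + v) = (h u * h v)%g, injective h,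
        forall g, g \in T <-> exists u, h u = g
      & forall u v, beta (h u) (h v) =
          sign_char F ((u *m hyperbolic k *m v^T) 0 0)].
Proof.
move=> elT qT [[b0 bMl bMr] bA bN]; have [f [fM f_inj fT]] := elT.
have fin u : f u \in T by apply/fT; exists u.
have f0 : f 0 = 1%g by apply: (mulgI (f 0)); rewrite -fM addr0 mulg1.
pose B := \matrix_(i, j) (if beta (f (delta_mx 0 i)) (f (delta_mx 0 j)) == 1
                          then 0 else 1 : 'F_2).
have BE i j : beta (f (delta_mx 0 i)) (f (delta_mx 0 j)) = sign_char F (B i j).
  rewrite mxE; case: eqP => [-> //|/eqP n1].
  have /eqP := beta_sqr elT qT (fin (delta_mx 0 i)) (fin (delta_mx 0 j)).
  by rewrite -expr2 sqrf_eq1 (negbTE n1) /= => /eqP.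
have b1l u : beta (f 0) (f u) = 1.
  by apply: (mulfI (b0 _ _ (fin 0) (fin u))); rewrite -bMl // -fM addr0 mulr1.
have b1r u : beta (f u) (f 0) = 1.
  by apply: (mulfI (b0 _ _ (fin u) (fin 0))); rewrite -bMr // -fM addr0 mulr1.
have betaE u v : beta (f u) (f v) = sign_char F ((u *m B *m v^T) 0 0).
  rewrite (@sign_char_coord _ _ (fun u => beta (f u) (f v)) (fun i => (B *m v^T) i 0)).
  - by rewrite -mulmxA mxE.
  - by move=> u1 u2; rewrite fM bMl.
  - exact: b1l.
  move=> i; rewrite (@sign_char_coord _ _ (fun v => beta _ (f v)) (fun j => B i j)).
  - rewrite [in RHS]mxE; congr sign_char; apply: eq_bigr => j _.
    by rewrite [v^T _ _]mxE mulrC.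
  - by move=> u1 u2; rewrite fM bMr.
  - exact: b1r.
  - exact: BE.
(* The strictly lower triangle of [B]; symmetry and the zero diagonal give [B = L + L^T]. *)
pose L := \matrix_(i, j) (if (j < i)%N then B i j else 0).
have Bsym i j : B i j = B j i.
  have [_ q2] := qT; rewrite !mxE !q2 // -!fM addrC -!mulrA.
  by rewrite (mulrC (tau (f (delta_mx 0 i)))).
have B0 i : B i i = 0 by rewrite mxE bA // eqxx.
have DB : B = L + L^T.
  apply/matrixP=> i j; rewrite [RHS]mxE [L^T _ _]mxE [L i j]mxE [L j i]mxE.
  by case: (ltngtP j i) => [_|_|/val_inj->]; rewrite ?addr0 ?add0r.
have uB : B \in unitmx.
  rewrite -row_free_unit; apply: inj_row_free => v vB.
  apply: f_inj; rewrite f0; apply: bN (fin v) _ => _ /fT[u <-].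
  by rewrite betaE vB mul0mx mxE.
have [k [P [Dn PBP]]] := symplectic_basis DB uB; rewrite -/(hyperbolic k) in PBP.
exists k, (fun u => f (u *m P)); split=> //.
(* As the hyperbolic matrix squares to the identity, [P] has trivial left kernel. *)
have HH : hyperbolic k *m hyperbolic k = 1%:M.
  by rewrite mulmx_block !mulmx0 !mul0mx !mulmx1 !addr0 !add0r -scalar_mx_block.
have freeP : row_free P.
  apply: inj_row_free => v vP; rewrite -[v]mulmx1 -HH mulmxA -{1}PBP !mulmxA vP.
  by rewrite !mul0mx.
have fullP : row_full P by rewrite /row_full (eqP freeP) -Dn.
split.
- by move=> u v; rewrite mulmxDl fM.
- by move=> u v /f_inj/(row_free_inj freeP).
- move=> g; split=> [/fT[v <-]|[u <-] //].
  by have /submxP[u ->] : (v <= P)%MS := submx_full _ fullP; exists u.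
by move=> u v; rewrite betaE trmx_mul -PBP !mulmxA.
Qed.

(** * Pauli matrices *)

Section PauliMatrices.
Variables (F : fieldType) (k : nat).

(** ['M_n.+1] carries the ring structure, so the size [2 ^ k] is given through its predecessor. *)
Definition pauli_size_pred := #|{: 'rV['F_2]_k}|.-1.
Local Notation N := pauli_size_pred.

Lemma pauli_sizeE : N.+1 = #|{: 'rV['F_2]_k}|.
Proof. by rewrite prednK //; apply/card_gt0P; exists 0. Qed.

Definition pauli_index (i : 'I_N.+1) : 'rV['F_2]_k :=
  enum_val (cast_ord pauli_sizeE i).

Lemma pauli_index_bij : bijective pauli_index.
Proof.
exists (fun v => cast_ord (esym pauli_sizeE) (enum_rank v)) => x.
  by rewrite enum_valK cast_ordK.
by rewrite /pauli_index cast_ordKV enum_rankK.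
Qed.

Definition dot (a c : 'rV['F_2]_k) : 'F_2 := (a *m c^T) 0 0.

Lemma dotDl a a' c : dot (a + a') c = dot a c + dot a' c.
Proof. by rewrite /dot mulmxDl mxE. Qed.

Lemma dotDr a c c' : dot a (c + c') = dot a c + dot a c'.
Proof. by rewrite /dot linearD mulmxDr mxE. Qed.

Lemma dotC a c : dot a c = dot c a.
Proof. by rewrite /dot -[c *m a^T]trmxK trmx_mul trmxK [RHS]mxE. Qed.

(* The operator e_x |-> (-1)^(p . (x + q)) e_(x + q), for u = (q, p), acting on
   row vectors indexed by 'rV['F_2]_k. *)
Definition pauli_mx (u : 'rV['F_2]_(k + k)) : 'M[F]_N.+1 :=
  \matrix_(i, j) ((pauli_index i + lsubmx u == pauli_index j)%:R
                  * sign_char F (dot (rsubmx u) (pauli_index j))).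

(** Both sides translate by the sum of the shifts; the phase of [u] is taken before the shift by [v]
    on the left and after it on the right, whence the sign. *)
Lemma pauli_mxM u v : pauli_mx u * pauli_mx v =
  sign_char F (dot (rsubmx u) (lsubmx v)) *: pauli_mx (u + v).
Proof.
apply/matrixP=> i l; rewrite !mxE.
have [idx' idxK idx'K] := pauli_index_bij.
rewrite (bigD1 (idx' (pauli_index i + lsubmx u))) //= big1 ?addr0 => [|j ji].
  rewrite !mxE idx'K eqxx mul1r !linearD /= addrA.
  case: eqP => [E|_]; last by rewrite !mul0r !mulr0.
  rewrite !mul1r -E -!sign_charD; congr sign_char.
  move: (_ + lsubmx u) => x; rewrite dotDl (dotDr (rsubmx u) x).
  rewrite [in RHS](addrC (dot (rsubmx u) x)) !addrA (_ : dot _ _ + dot _ (lsubmx v) = 0).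
    by rewrite add0r.
  exact: addrF2.
rewrite !mxE (negbTE (_ : pauli_index i + lsubmx u != pauli_index j)) ?mul0r //.
by apply: contraNneq ji => ->; rewrite idxK.
Qed.

Lemma pauli_mx0 : pauli_mx 0 = 1.
Proof.
apply/matrixP=> i j; rewrite !mxE !linear0 addr0 /dot mul0mx mxE mulr1.
by rewrite (bij_eq pauli_index_bij).
Qed.

Lemma pauli_mx_unit u : pauli_mx u \is a GRing.unit.
Proof.
have E : pauli_mx u * pauli_mx u = sign_char F (dot (rsubmx u) (lsubmx u)) *: 1.
  by rewrite pauli_mxM addmxF2 pauli_mx0.
rewrite -(unitrX_pos _ (isT : 0 < 2)%N) expr2 E scaler_unit ?unitr1 //.
by rewrite unitfE signr_eq0.
Qed.

Lemma pauli_mx_comm u v : pauli_mx u * pauli_mx v =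
  sign_char F ((u *m hyperbolic k *m v^T) 0 0) *: (pauli_mx v * pauli_mx u).
Proof.
rewrite !pauli_mxM scalerA [v + u]addrC -sign_charD; congr (sign_char _ _ *: _).
rewrite -{2}[u]hsubmxK -{2}[v]hsubmxK tr_row_mx mul_row_block mul_row_col.
rewrite !mulmx0 !mulmx1 add0r addr0 mxE -/(dot _ _) -/(dot _ _).
by rewrite [dot (rsubmx v) _]dotC -addrA addrF2 addr0.
Qed.

End PauliMatrices.

(** * Realization of the algebra D_inv(T, beta, tau) by Pauli matrices *)

Section Existence.
Variables (F : fieldType) (G : groupType).
Hypothesis charF : 2%N \notin [pchar F].
Hypothesis abG : forall g h : G, (g * h)%g = (h * g)%g.
Variables (m : nat) (T : {fset G}) (t : G) (beta : G -> G -> F) (tau : G -> F).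
Hypothesis dat : ex_datum m T t beta tau.

Let elT : elementary2_subgroup (2 * m) T. Proof. by case: dat. Qed.
Let qT : quadratic_form T tau beta. Proof. by case: dat. Qed.

Lemma exists_Dinv : exists D : grInvAlg F G, is_Dinv T beta tau D.
Proof.
have [k [h [_ [hM h_inj hT hbeta]]]] : exists k (h : 'rV['F_2]_(k + k) -> G),
    (2 * m = k + k)%N /\ [/\ forall u v, h (u + v) = (h u * h v)%g, injective h,
        forall g, g \in T <-> exists u, h u = g
      & forall u v, beta (h u) (h v) =
          sign_char F ((u *m hyperbolic k *m v^T) 0 0)].
  by apply: (symplectic_coordinates charF elT qT); case: dat.
pose N := pauli_size_pred k; pose A : falgType F := 'M[F]_N.+1.
pose hinv g := odflt 0 [pick u | h u == g].
have hK u : hinv (h u) = u.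
  by rewrite /hinv; case: pickP => [v /eqP/h_inj|/(_ u)/eqP].
pose w g : A := pauli_mx F (hinv g).
have w0 g : w g != 0.
  by apply: contraTneq (pauli_mx_unit F (hinv g)) => E; rewrite -/(w g) E unitr0.
have wM g u : g \in T -> u \in T -> exists c, w g * w u = c *: w (g * u)%g.
  move=> /hT[x <-] /hT[y <-]; rewrite -hM /w !hK pauli_mxM; eexists.
  by [].
have wC g u : g \in T -> u \in T -> w g * w u = beta g u *: (w u * w g).
  by move=> /hT[x <-] /hT[y <-]; rewrite hbeta /w !hK pauli_mx_comm.
pose Gamma g : {vspace A} := if g \in T then <[w g]>%VS else 0%VS.
have GammaP g x : x \in Gamma g -> x != 0 -> g \in T /\ exists c, x = c *: w g.
  rewrite /Gamma; case: ifP => _; last by rewrite memv0 => ->.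
  by move=> /vlineP.
have wG g : g \in T -> w g \in Gamma g by rewrite /Gamma => ->; apply: memv_line.
have dir (s : seq G) (y : G -> A) : uniq s -> (forall g, y g \in Gamma g) ->
    \sum_(g <- s) y g = 0 -> {in s, forall g, y g = 0}.
  move=> us yG sum0 g gs; apply/eqP; rewrite -memv0; move: g gs.
  (* Directness is the case of the zero subspace, with conjugations by the [w u] as separating
     operators. *)
  apply: eigen_separation us _ _; last by rewrite sum0 mem0v.
  move=> g g' gs g's gg' yg yg'.
  have [[gT _] [g'T _]] := (GammaP _ _ (yG g) yg, GammaP _ _ (yG g') yg').
  have [u uT bu] := beta_separates abG dat gT g'T gg'.
  have uU : w u \is a GRing.unit := pauli_mx_unit F _.
  exists (amull (w u) \o amulr ((w u)^-1)%R)%VF, (beta u); split=> // [|j js].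
    apply/subvP=> _ /memv_imgP[z + ->]; rewrite memv0 => /eqP->.
    by rewrite linear0 mem0v.
  rewrite comp_lfunE !lfunE /=; have [->|yj] := eqVneq (y j) 0.
    by rewrite mul0r mulr0 scaler0.
  have [jT [c ->]] := GammaP _ _ (yG j) yj.
  rewrite mulrA -scalerAr (wC _ _ uT jT) -!scalerAl mulrK // !scalerA.
  by rewrite mulrC.
have free_w : free [seq w g | g <- T].
  by apply: (graded_free dir (fset_uniq T) wG) => g _; apply: w0.
have span_w : <<[seq w g | g <- T]>>%VS = fullv.
  apply/eqP; rewrite eqEdim subvf (eqP free_w) size_map dimvf.
  (* Matrices of size [2 ^ k] have dimension [2 ^ (k + k)], the order of [T]. *)
  have -> : dim A = #|{: 'rV['F_2]_(k + k)}|.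
    rewrite -[LHS](dim_matrix F N.+1 N.+1) [in LHS]pauli_sizeE !card_mx !mul1n.
    by rewrite expnD.
  rewrite cardE -(size_map h); apply: uniq_leq_size.
    by rewrite map_inj_uniq ?enum_uniq.
  by move=> _ /mapP[u _ ->]; apply/hT; exists u.
have [phi0 phiE] := linear_of_free [seq w g | g <- T] [seq tau g *: w g | g <- T].
have {}phiE := phiE free_w (etrans (size_map _ _) (esym (size_map _ _))).
have phiw g : g \in T -> phi0 (w g) = tau g *: w g.
  by move=> gT; move: phiE; rewrite -map_comp => /eq_in_map/(_ g gT).
exists (@GrInvAlg F G A (linfun phi0) Gamma); split; last first.
  move=> g gT d; rewrite /= /Gamma gT => /vlineP[c ->].
  by rewrite lfunE linearZ /= phiw // !scalerA mulrC.
split; split=> /=.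
- exists N, (linfun_ahom (@idfun A)); exists id => x; rewrite lfunE //.
- split=> //.
    move=> x; exists T; have := memvf x; rewrite -span_w span_def big_map.
    rewrite (@eq_big_seq _ _ _ _ _ (fun g => <[w g]>%VS) Gamma) // => g gT.
    by rewrite /Gamma (gT : g \in T).
  move=> g u; apply/prodvP=> x y xg yu.
  have [->|x0] := eqVneq x 0; first by rewrite mul0r mem0v.
  have [->|y0] := eqVneq y 0; first by rewrite mulr0 mem0v.
  have [[gT [c ->]] [uT [d ->]]] := (GammaP _ _ xg x0, GammaP _ _ yu y0).
  have [e De] := wM g u gT uT.
  rewrite -scalerAl -scalerAr De !memvZ // wG //; exact: elementary2_M elT gT uT.
- move=> g x xg x0; have [gT [c Dx]] := GammaP _ _ xg x0.
  rewrite Dx scaler_unit ?pauli_mx_unit // unitfE.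
  by apply: contraNneq x0 => c0; rewrite Dx c0 scale0r.
- move=> g; rewrite /Gamma; case: ifP => gT; last by rewrite eqxx.
  by rewrite -dimv_eq0 dim_vline w0.
- by move=> g gT; rewrite /Gamma gT dim_vline w0.
move=> g g' gT g'T x y; rewrite /Gamma gT g'T => /vlineP[c ->] /vlineP[d ->].
rewrite -!scalerAl -!scalerAr wC // !scalerA; congr (_ *: _).
by rewrite mulrC !mulrA mulrAC.
Qed.

End Existence.

(** * Structure of the nonsimple algebras *)

(** Enlarge a subgroup [T] avoiding [t]: if [s] in [S] lies outside [T<t>], then [T<s>] still avoids
    [t]. *)
Lemma elementary2_complement (G : groupType)
    (abG : forall g h : G, (g * h)%g = (h * g)%g) (S : {fset G}) t :
    1%g \in S -> {in S &, forall g h, (g * h)%g \in S} ->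
    {in S, forall g, (g * g)%g = 1%g} -> t \in S -> t != 1%g ->
  exists r (T : {fset G}),
    [/\ elementary2_subgroup r T, t \notin T & adjoin T t = S].
Proof.
move=> S1 SM S2 tS t1.
(* [d] strictly bounds the number of elements of [S] outside [T], which decreases at each
   enlargement. *)
suff ext d r (T : {fset G}) : elementary2_subgroup r T -> (T `<=` S)%fset ->
    t \notin T -> (#|` S| - #|` T| < d)%N ->
    exists r (T : {fset G}),
      [/\ elementary2_subgroup r T, t \notin T & adjoin T t = S].
  apply: (ext #|` S|.+1 0%N [fset 1%g]%fset); last by rewrite ltnS leq_subr.
  - exists (fun=> 1%g); split=> [_ _|u v _|g].
    + by rewrite mulg1.
    + by rewrite (thinmx0 u) (thinmx0 v).
    + by rewrite in_fset1; split=> [/eqP->|[_ ->]] //; exists 0.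
  - by rewrite fsub1set.
  - by rewrite in_fset1.
elim: d r T => [//|d IHd] r T elT TS tT ltd.
have ord2 s : s \in S -> s != 1%g -> has_order2 s by split; last exact: S2.
have sub s : s \in S -> (adjoin T s `<=` S)%fset.
  move=> sS; apply/fsubsetP=> g; rewrite mem_adjoin => /orP[/(fsubsetP TS)//|].
  by move=> /(fsubsetP TS) gS; rewrite -[g](mulgVK s) SM.
have [eS|nS] := eqVneq (adjoin T t) S; first by exists r, T.
have /fsubsetPn[s sS sT] : ~~ (S `<=` adjoin T t)%fset.
  by apply: contra nS => Ssub; rewrite eqEfsubset sub.
move: sT; rewrite mem_adjoin negb_or => /andP[sT stT].
have s1 : s != 1%g by apply: contraNneq sT => ->; apply: elementary2_1 elT.
have sV := order2V (ord2 s sS s1); have tV := order2V (ord2 t tS t1).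
apply: (IHd (r + 1)%N (adjoin T s)).
- exact: (adjoin_elementary2 abG elT (ord2 s sS s1) sT).
- exact: sub.
- by rewrite mem_adjoin negb_or tT sV abG -tV.
have TsS : (T `<` adjoin T s)%fset.
  rewrite fproperEneq; apply/andP; split.
    by apply: contraNneq sT => ->; rewrite mem_adjoin mulgV (elementary2_1 elT) orbT.
  by apply/fsubsetP=> g gT; rewrite mem_adjoin gT.
rewrite -ltnS (leq_trans _ ltd) // ltnS; have ltT := fproper_ltn_card TsS.
by apply: ltn_sub2l => //; apply: leq_trans ltT _; apply: fsubset_leq_card; apply: sub.
Qed.

Section Structure.
Variables (F : closedFieldType) (G : groupType).
Hypothesis charF : 2%N \notin [pchar F].
Hypothesis abG : forall g h : G, (g * h)%g = (h * g)%g.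
Variable D : grInvAlg F G.
Hypothesis simD : graded_division_simple_inv D.

Let gr : is_grading (gia_gr D). Proof. by case: simD. Qed.
Let div : graded_division (gia_gr D). Proof. by case: simD. Qed.
Let phiK : involutive (gia_inv D). Proof. by case: simD => _ _ [H _] _ _; apply: H. Qed.
Let phiM x y : gia_inv D (x * y) = gia_inv D y * gia_inv D x.
Proof. by case: simD => _ _ [_ ->]. Qed.

(* An element y z^-1 - a is not invertible for some scalar a, so the homogeneous
   element y - a z vanishes. *)
Lemma graded_division_line g (y z : D) :
  y \in gia_gr D g -> z \in gia_gr D g -> z != 0 -> exists a, y = a *: z.
Proof.
move=> yg zg z0; have zU := div zg z0.
have [a] := exists_sub_scalar_nonunit (y / z).
have -> : y / z - a%:A = (y - a *: z) / z.
  by rewrite mulrBl -scalerAl mulrV.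
rewrite unitrMl ?unitrV // => nU; exists a; apply/eqP; rewrite -subr_eq0.
by apply: contraNT nU; apply: (div (g := g)); rewrite memvB ?memvZ.
Qed.

(** One chosen vector of the line decides the sign; a zero component gets sign 1. *)
Definition gr_sign g : F :=
  if gia_inv D (vpick (gia_gr D g)) == vpick (gia_gr D g) then 1 else -1.

(** Taken to be the polar form of [gr_sign], so that the quadratic form identity holds by
    definition; [gr_commE] identifies it with the commutation factor. *)
Definition gr_comm g h : F := gr_sign (g * h)%g * gr_sign g * gr_sign h.

Lemma gr_sign_sqr g : gr_sign g * gr_sign g = 1.
Proof. by rewrite /gr_sign; case: ifP; rewrite ?mulrNN mulr1. Qed.

Lemma gr_comm_sqr g h : gr_comm g h * gr_comm g h = 1.
Proof. by rewrite /gr_comm mulrACA gr_sign_sqr mulr1 mulrACA !gr_sign_sqr mulr1. Qed.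

(** The involution maps the line of degree [g] to itself, hence acts there by a scalar of square
    1. *)
Lemma gr_signE g x : x \in gia_gr D g -> gia_inv D x = gr_sign g *: x.
Proof.
move=> xg; set z := vpick (gia_gr D g); have zg : z \in gia_gr D g := memv_pick _.
have [z0|z0] := eqVneq z 0.
  move/eqP: z0; rewrite vpick0 => /eqP g0; move: xg; rewrite g0 memv0 => /eqP->.
  by rewrite linear0 scaler0.
have [a ->] := graded_division_line xg zg z0.
suff Dz : gia_inv D z = gr_sign g *: z by rewrite linearZ /= Dz !scalerA mulrC.
have phig : gia_inv D z \in gia_gr D g.
  by case: simD => _ _ _ stab _; apply: (subvP (stab g)); apply: memv_img.
have [c Dc] := graded_division_line phig zg z0.
have : c ^+ 2 == 1.
  apply/eqP; apply: (scalerIv z0); rewrite /= scale1r expr2 -scalerA -Dc.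
  by rewrite -linearZ /= -Dc phiK.
rewrite /gr_sign -/z Dc sqrf_eq1 => /orP[] /eqP->; first by rewrite scale1r eqxx scale1r.
by case: eqP => // ->; rewrite scale1r.
Qed.

(** The involution sends [x * y] to [gr_sign (g * h)] times itself, and also to
    [gr_sign g * gr_sign h] times [y * x]. *)
Lemma gr_commE g h x y : x \in gia_gr D g -> y \in gia_gr D h ->
  x * y = gr_comm g h *: (y * x).
Proof.
move=> xg yh; have := phiM x y; rewrite (gr_signE (graded_mul gr xg yh)).
rewrite (gr_signE xg) (gr_signE yh) -scalerAl -scalerAr scalerA.
move/(congr1 ( *:%R (gr_sign (g * h)%g))); rewrite !scalerA gr_sign_sqr scale1r => ->.
by rewrite mulrA mulrAC.
Qed.

Lemma gr_support : exists S : {fset G}, pauli_graded S gr_comm gr_sign D.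
Proof.
have [s [_ _ sG _]] := graded_finite gr.
exists [fset g in s | gia_gr D g != 0%VS]%fset.
have memS g : (g \in [fset g in s | gia_gr D g != 0%VS]%fset) = (gia_gr D g != 0%VS).
  by rewrite !inE /= andb_idl //; apply: sG.
split=> // [g|g h x y|g x]; [|exact: gr_commE|exact: gr_signE].
rewrite memS -vpick0 => z0; have zg := memv_pick (gia_gr D g).
suff -> : gia_gr D g = <[vpick (gia_gr D g)]>%VS by rewrite dim_vline z0.
apply/vspaceP=> x; apply/idP/vlineP=> [xg|[a ->]]; last exact: memvZ.
exact: graded_division_line xg zg z0.
Qed.

(* Otherwise the ideal generated by a noninvertible x - a, with x of degree g, would
   be proper. *)
Lemma symmetric_radical_trivial S g : pauli_graded S gr_comm gr_sign D ->
  g \in S -> {in S, forall h, gr_comm g h = 1} -> gr_sign g = 1 -> g = 1%g.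
Proof.
move=> pD gS rad sg; have [x xg x0] := pauli_ex pD gS.
have [a nU] := exists_sub_scalar_nonunit x; set z := x - a%:A in nU.
have xC y : x * y = y * x.
  elim/(graded_ind gr): y => [|y y' Ey Ey'|h y yh].
  - by rewrite mulr0 mul0r.
  - by rewrite mulrDr Ey Ey' mulrDl.
  have [->|y0] := eqVneq y 0; first by rewrite mulr0 mul0r.
  by rewrite (gr_commE xg yh) rad ?scale1r // (pauli_supp pD yh y0).
have zC y : z * y = y * z by rewrite mulrBl mulrBr xC -scalerAl -scalerAr mul1r mulr1.
have phi1 : gia_inv D 1 = 1.
  by have := phiM (gia_inv D 1) 1; rewrite mulr1 phiK mulr1 => <-.
have phiz : gia_inv D z = z by rewrite linearB linearZ /= (gr_signE xg) sg scale1r phi1.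
pose I : {vspace D} := limg (amull z).
have zI y : z * y \in I by rewrite -[z * y](lfunE (z \*o idfun)); apply: memv_img (memvf _).
have IP y : y \in I -> exists w, y = z * w.
  by move=> /memv_imgP[w _ ->]; exists w; rewrite lfunE.
have [_ _ _ _ simple] := simD.
have idI : two_sided_ideal I.
  split; apply/prodvP=> y w; first by move=> _ /IP[v ->]; rewrite mulrA -zC -mulrA.
  by move=> /IP[v ->] _; rewrite -mulrA.
have stI : (gia_inv D @: I <= I)%VS.
  apply/subvP=> _ /memv_imgP[y /IP[w ->] ->].
  by rewrite phiM phiz -zC.
have [I0|If] := simple I idI stI.
  have : z * 1 \in I by apply: zI.
  rewrite I0 memv0 mulr1 subr_eq0 => /eqP Dx.
  apply: (graded_disjoint gr xg _ x0).
  by rewrite Dx memvZ // (graded_one gr).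
have /IP[w zw] : 1 \in I by rewrite If memvf.
by case/negP: nU; apply/unitrP; exists w; rewrite -zC -zw.
Qed.

Lemma nonsimple_exchange : ~ simple_algebra D ->
  exists (m : nat) (T : {fset G}) (t : G) (beta : G -> G -> F) (tau : G -> F),
    ex_datum m T t beta tau /\
    exists D0 : grInvAlg F G, is_Dinv T beta tau D0 /\ gia_iso D (gia_ex t D0).
Proof.
move=> nsimple; have [S pD] := gr_support.
have [_ bMl bMr] := pauli_bicharacter pD; have bA := pauli_alternating pD.
have S1 := pauli_supp1 pD; have SM := pauli_suppM pD.
have signM g h : gr_sign (g * h)%g = gr_comm g h * gr_sign g * gr_sign h.
  rewrite /gr_comm -!mulrA (mulrCA (gr_sign h) (gr_sign g)).
  by rewrite gr_sign_sqr mulr1 gr_sign_sqr mulr1.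
have bC g h : gr_comm g h = gr_comm h g by rewrite /gr_comm abG mulrAC.
(* A square is radical because the values of [gr_comm] have square 1, and it has sign 1 because the
   form is alternating. *)
have S2 : {in S, forall g, (g * g)%g = 1%g}.
  move=> g gS; apply: (symmetric_radical_trivial pD (SM _ _ gS gS)) => [h hS|].
    by rewrite bMl // gr_comm_sqr.
  by rewrite signM bA // mul1r gr_sign_sqr.
have [t tS [t1 radt]] : exists2 t, t \in S &
    t != 1%g /\ {in S, forall h, gr_comm t h = 1}.
  have [/hasP[t tS /andP[t1 /allP rt]]|/hasPn norad] := boolP
      (has (fun t => (t != 1%g) && all (fun h => gr_comm t h == 1) S) S).
    by exists t => //; split=> // h hS; apply/eqP/rt.
  (* With trivial radical the conjugations alone separate the degrees, so [D] would be simple. *)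
  case: nsimple => I idI; have [->|I0] := eqVneq I 0%VS; [by left | right].
  apply: (pauli_ideal pD idI I0) => g h gS hS gh; left.
  have := norad _ (SM _ _ gS hS); rewrite negb_and negbK => /orP[/eqP E|].
    by case/eqP: gh; apply: (mulIg h); rewrite E S2.
  move/allPn=> [u uS nb]; exists u => //; apply: contra nb => /eqP bu.
  by rewrite bC bMr // bu gr_comm_sqr.
have signt : gr_sign t = -1.
  have := symmetric_radical_trivial pD tS radt.
  by rewrite /gr_sign; case: ifP => // _ /(_ erefl)/eqP; rewrite (negbTE t1).
have [r [T [elT tT adT]]] := elementary2_complement abG S1 SM S2 tS t1.
have ord2 : has_order2 t by split; last exact: S2.
have TS g : g \in T -> g \in S by rewrite -adT mem_adjoin => ->.
have qT : quadratic_form T gr_sign gr_comm.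
  by split=> // g gT; rewrite /gr_sign; case: ifP; [left | right].
have [b0 _ _] := pauli_bicharacter pD.
have bT : bicharacter T gr_comm.
  split=> [g h gT hT|g g' h gT g'T hT|h g g' hT gT g'T].
  - by apply: b0; apply: TS.
  - by apply: bMl; apply: TS.
  - by apply: bMr; apply: TS.
have bt g : g \in S -> gr_comm g t = 1 by move=> gS; rewrite bC radt.
have T_part_S g : g \in S -> g = (T_part T t g * t ^+ (g \notin T))%g.
  by rewrite /T_part; case: ifP => //=; rewrite ?expg0 ?mulg1 // expg1 mulgVK.
have ndT : Defs.nondegenerate T gr_comm.
  move=> g gT rad; have gS := TS g gT.
  have radS h : h \in S -> gr_comm g h = 1.
    rewrite -adT => hS; have := T_part_in hS; rewrite adT in hS.
    rewrite [in X in _ -> X](T_part_S h hS) => pT; have pS := TS _ pT.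
    case: (h \notin T); first by rewrite expg1 bMr // bt // mulr1 rad.
    by rewrite expg0 mulg1 rad.
  have [sg|/eqP sg] := eqVneq (gr_sign g) 1.
    exact: symmetric_radical_trivial pD gS radS sg.
  (* A radical [g] of sign -1 makes [g * t] radical of sign 1, hence trivial; then [g = t], which is
     not in [T]. *)
  have gt1 : (g * t)%g = 1%g.
    apply: (symmetric_radical_trivial pD (SM _ _ gS tS)) => [h hS|].
      by rewrite bMl // radS // radt // mulr1.
    rewrite signM radS // signt mul1r; have [q1 _] := qT.
    by case: (q1 g gT) => [/sg//|->]; rewrite mulrNN mulr1.
  have gt : g = t by apply: (mulIg t); rewrite gt1 S2.
  by rewrite gt (negbTE tT) in gT.
have [k [_ [Dr _]]] := symplectic_coordinates charF elT qT
  (And3 bT (fun g gT => bA g (TS g gT)) ndT).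
have dat : ex_datum k T t gr_comm gr_sign.
  split=> //; last by split=> // g gT; apply: bA; apply: TS.
  by rewrite mul2n -addnn -Dr.
exists k, T, t, gr_comm, gr_sign; split=> //.
have [D0 Di] := exists_Dinv charF abG dat; exists D0; split=> //.
have elS := adjoin_elementary2 abG elT ord2 tT.
apply: (pauli_iso elS _ (Dinv_ex_pauli charF abG dat Di)).
have pS g : g \in S -> T_part T t g \in S.
  by rewrite -{1}adT => /T_part_in; apply: TS.
(* Multiplication by the radical element [t] leaves [gr_comm] unchanged, so it is the extension of
   its restriction to [T]. *)
have eb : {in S &, gr_comm =2 beta_ext T t gr_comm}.
  move=> g h gS hS; rewrite /beta_ext {1}(T_part_S g gS) {1}(T_part_S h hS).
  have bpt x y (c : bool) : x \in S -> y \in S -> gr_comm (x * t ^+ c)%g y = gr_comm x y.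
    move=> xS yS; case: c; last by rewrite expg0 mulg1.
    by rewrite expg1 bMl // radt // mulr1.
  rewrite bpt ?pS //; last by rewrite -T_part_S.
  by rewrite bC bpt ?pS // bC.
have emu : {in S, gr_sign =1 tau_ext T t gr_sign}.
  move=> g gS; rewrite tau_ext_part {1}(T_part_S g gS); case: (g \notin T).
    by rewrite !expg1 signM bt ?pS // signt mul1r mulrC.
  by rewrite expg0 mulg1 mul1r.
by rewrite adT; apply: eq_pauli eb emu pD.
Qed.

End Structure.

Unset Implicit Arguments.

Theorem theorem5p14 (F : closedFieldType) (charF : 2%N \notin [pchar F])
    (G : groupType) (abG : forall g h : G, (g * h)%g = (h * g)%g) :
  (forall (m : nat) (T : {fset G}) (t : G) (beta : G -> G -> F) (tau : G -> F),
     ex_datum m T t beta tau ->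
     forall D : grInvAlg F G, is_Dinv T beta tau D ->
       graded_division_simple_inv (gia_ex t D) /\
       ~ simple_algebra (gia_ex t D))
  /\
  (forall D : grInvAlg F G,
     graded_division_simple_inv D -> ~ simple_algebra D ->
     exists (m : nat) (T : {fset G}) (t : G) (beta : G -> G -> F)
            (tau : G -> F),
       ex_datum m T t beta tau /\
       exists D0 : grInvAlg F G,
         is_Dinv T beta tau D0 /\ gia_iso D (gia_ex t D0))
  /\
  (forall (m1 m2 : nat) (T1 T2 : {fset G}) (t1 t2 : G)
          (beta1 beta2 : G -> G -> F) (tau1 tau2 : G -> F),
     ex_datum m1 T1 t1 beta1 tau1 ->
     ex_datum m2 T2 t2 beta2 tau2 ->
     forall D1 D2 : grInvAlg F G,
       is_Dinv T1 beta1 tau1 D1 -> is_Dinv T2 beta2 tau2 D2 ->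
       (gia_iso (gia_ex t1 D1) (gia_ex t2 D2) <->
        [/\ adjoin T1 t1 = adjoin T2 t2,
            t1 = t2,
            {in adjoin T1 t1 &, beta_ext T1 t1 beta1 =2 beta_ext T2 t2 beta2}
          & {in adjoin T1 t1, tau_ext T1 t1 tau1 =1 tau_ext T2 t2 tau2}])).
Proof.
split=> [m T t beta tau dat D Di|]; last split.
- split; last exact: gia_ex_not_simple.
  exact: (gia_ex_division_simple charF abG dat Di).
- by move=> D simD nsimple; apply: nonsimple_exchange.
by move=> m1 m2 T1 T2 t1 t2 b1 b2 tau1 tau2 dat1 dat2 D1 D2; apply: (ex_iso_iff abG charF dat1 dat2).
Qed.
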